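(* Let $\mathbb F$ be a field of characteristic $0$. Let $\{\lambda^n\}_{n\ge0}$ be a graded partition sequence and for each $n\geq0$ put $u_n=s_{\lambda^n}$. Then the set $\{u_n\}_{n\geq0}$ is algebraically independent over $\mathbb F$ and generates $\Lambda_\mathbb{F}$ as an $\mathbb F$-algebra if and only if, for each $n\geq0$, $\lambda^n$ is a hook.
   Context: $\Lambda_{\mathbb F}$ is the ring of symmetric functions in infinitely many variables over $\mathbb F$ and $s_\lambda$ is the Schur function. A graded partition sequence is a sequence $\{\lambda^n\}_{n\ge0}$ with $\lambda^n$ a partition of $n$. A hook is a partition of the form $(a,1^b)$ with $a\ge1$, $b\ge0$ (the empty partition, for $n=0$, is regarded as a hook).
   Formalization: Algebraic independence is stated for {u_n} with n≥1 rather than n≥0, because u_0 is the Schur function of the empty partition, i.e. the constant 1, which is algebraic over F; generation is still stated for n≥0. *)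

(* Defs.v *)
From HB Require Import structures.
From mathcomp Require Import all_boot all_order all_algebra.
From mathcomp Require Import boolp.
From mathcomp Require Import mpoly.

Set Implicit Arguments.
Unset Strict Implicit.
Unset Printing Implicit Defensive.

Import GRing.Theory.
Local Open Scope ring_scope.

(* The product algebra \prod_N F[x_0, ..., x_(N-1)]. *)
Definition mpfam (F : fieldType) : Type := forall N : nat, {mpoly F[N]}.

Section Family.
Variable F : fieldType.
Implicit Types f g h : mpfam F.

HB.instance Definition _ := gen_eqMixin (mpfam F).
HB.instance Definition _ := gen_choiceMixin (mpfam F).

Lemma mpfamP f g : (forall N, f N = g N) -> f = g.
Proof. by move=> fg; apply: functional_extensionality_dep. Qed.

Definition fam0 : mpfam F := fun=> 0.
Definition fam1 : mpfam F := fun=> 1.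
Definition famN f : mpfam F := fun N => - f N.
Definition famD f g : mpfam F := fun N => f N + g N.
Definition famM f g : mpfam F := fun N => f N * g N.
Definition famZ (a : F) f : mpfam F := fun N => a *: f N.

Fact famDA : associative famD.
Proof. by move=> f g h; apply: mpfamP => N; apply: addrA. Qed.
Fact famDC : commutative famD.
Proof. by move=> f g; apply: mpfamP => N; apply: addrC. Qed.
Fact fam0D : left_id fam0 famD.
Proof. by move=> f; apply: mpfamP => N; apply: add0r. Qed.
Fact famND : left_inverse fam0 famN famD.
Proof. by move=> f; apply: mpfamP => N; apply: addNr. Qed.

HB.instance Definition _ :=
  GRing.isZmodule.Build (mpfam F) famDA famDC fam0D famND.

Fact famMA : associative famM.
Proof. by move=> f g h; apply: mpfamP => N; apply: mulrA. Qed.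
Fact famMC : commutative famM.
Proof. by move=> f g; apply: mpfamP => N; apply: mulrC. Qed.
Fact fam1M : left_id fam1 famM.
Proof. by move=> f; apply: mpfamP => N; apply: mul1r. Qed.
Fact famMDl : left_distributive famM famD.
Proof. by move=> f g h; apply: mpfamP => N; apply: mulrDl. Qed.
Fact fam1_neq0 : fam1 != fam0.
Proof.
apply/eqP => /(congr1 (fun f : mpfam F => f 0%N)) /eqP.
by rewrite /fam1 /fam0 oner_eq0.
Qed.

HB.instance Definition _ := GRing.Zmodule_isComNzRing.Build (mpfam F)
  famMA famMC fam1M famMDl fam1_neq0.

Fact famZA a b f : famZ a (famZ b f) = famZ (a * b) f.
Proof. by apply: mpfamP => N; apply: scalerA. Qed.
Fact famZ1 : left_id 1 famZ.
Proof. by move=> f; apply: mpfamP => N; apply: scale1r. Qed.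
Fact famZDr : right_distributive famZ +%R.
Proof. by move=> a f g; apply: mpfamP => N; apply: scalerDr. Qed.
Fact famZDl f : {morph famZ^~ f : a b / a + b}.
Proof. by move=> a b; apply: mpfamP => N; apply: scalerDl. Qed.

HB.instance Definition _ :=
  GRing.Zmodule_isLmodule.Build F (mpfam F) famZA famZ1 famZDr famZDl.

Fact famZAl (a : F) f g : a *: (f * g) = a *: f * g.
Proof. by apply: mpfamP => N; apply: scalerAl. Qed.

HB.instance Definition _ := GRing.Lmodule_isLalgebra.Build F (mpfam F) famZAl.

Fact famZAr (a : F) f g : a *: (f * g) = f * (a *: g).
Proof. by apply: mpfamP => N; apply: scalerAr. Qed.

HB.instance Definition _ := GRing.Lalgebra_isAlgebra.Build F (mpfam F) famZAr.

End Family.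

(* F[x_0, ..., x_N] -> F[x_0, ..., x_(N-1)], setting the last variable to 0. *)
Definition restrict_last (F : fieldType) (N : nat) (p : {mpoly F[N.+1]}) :
    {mpoly F[N]} :=
  p \mPo [tuple if unlift ord_max i is Some j then 'X_j else 0 | i < N.+1].

(* Symmetric functions as the inverse limit, in the category of graded
   algebras, of the algebras of symmetric polynomials in N variables: the
   bound on the degrees is uniform in N. *)
Definition is_symfun (F : fieldType) (f : mpfam F) : Prop :=
  [/\ forall N, f N \is symmetric,
      forall N, restrict_last (f N.+1) = f N
    & exists d : nat, forall N, (msize (f N) <= d)%N].

Definition Lambda (F : fieldType) : {pred mpfam F} := fun f => `[< is_symfun f >].
Arguments Lambda F : clear implicits.

Fact Lambda_subalg (F : fieldType) : subalg_closed (Lambda F).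
Proof.
split.
- apply/asboolP; split=> [N|N|]; first exact: rpred1.
  + by rewrite /restrict_last rmorph1.
  + by exists 1%N => N; rewrite msize1.
- move=> a f g /asboolP[sf rf [df hf]] /asboolP[sg rg [dg hg]].
  apply/asboolP; split=> [N|N|].
  + by apply: rpredD; [apply: rpredZ; apply: sf | apply: sg].
  + have -> : (a *: f + g) N = a *: f N + g N by [].
    by rewrite -rf -rg /restrict_last -comp_mpolyZ -rmorphD.
  + exists (maxn df dg) => N; apply: leq_trans (msizeD_le _ _) _.
    rewrite geq_max !leq_max (leq_trans (msizeZ_le _ _) (hf N)) /=.
    by rewrite hg orbT.
- move=> f g /asboolP[sf rf [df hf]] /asboolP[sg rg [dg hg]].
  apply/asboolP; split=> [N|N|].
  + by apply: rpredM; [apply: sf | apply: sg].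
  + have -> : (f * g) N = f N * g N by [].
    by rewrite -rf -rg /restrict_last -rmorphM.
  + exists (df + dg)%N => N; apply: leq_trans (leq_add (hf N) (hg N)).
    change (msize (f N * g N) <= msize (f N) + msize (g N))%N.
    have [->|nz_f] := eqVneq (f N) 0; first by rewrite mul0r msize0.
    have [->|nz_g] := eqVneq (g N) 0; first by rewrite mulr0 msize0.
    by rewrite msizeM // leq_pred.
Qed.

HB.instance Definition _ (F : fieldType) :=
  GRing.isSubalgClosed.Build F (mpfam F) (Lambda F)
    (GRing.subalg_closed_semi (Lambda_subalg F)).

Definition is_part (n : nat) (s : seq nat) : bool :=
  [&& sorted geq s, 0%N \notin s & sumn s == n].

Definition is_hook (s : seq nat) : Prop :=
  s = [::] \/ exists a b : nat, (1 <= a)%N /\ s = a :: nseq b 1%N.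

(* Cells of the Young diagram: row i and column j, with j < s_i. *)
Definition cell (s : seq nat) : finType :=
  {i : 'I_(size s) & 'I_(nth 0%N s i)}.

Definition cell_row (s : seq nat) (c : cell s) : nat := tag c.
Definition cell_col (s : seq nat) (c : cell s) : nat := tagged c.

(* Semistandard fillings: weakly increasing along rows, strictly increasing
   down columns. *)
Definition ssyt (s : seq nat) (N : nat) (T : {ffun cell s -> 'I_N}) : bool :=
  [forall c, forall d,
     ((cell_row c == cell_row d) && (cell_col c <= cell_col d)%N
        ==> (T c <= T d)%N)
  && ((cell_col c == cell_col d) && (cell_row c < cell_row d)%N
        ==> (T c < T d)%N)].

(* s_lambda as the family of its generating polynomials over the semistandard
   tableaux with entries in the N-letter alphabet 'I_N. Since schur F [::] = 1,
   index 0 has to be left out whenever a family of Schur functions, one for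
   each n, is to be algebraically independent. *)
Definition schur (F : fieldType) (s : seq nat) : mpfam F :=
  fun N => \sum_(T : {ffun cell s -> 'I_N} | ssyt T) \prod_(c : cell s) 'X_(T c).
Arguments schur F s : clear implicits.

Definition peval (F : fieldType) (A : comAlgType F) (u : nat -> A) (m : nat)
    (P : {mpoly F[m]}) : A :=
  mmap (in_alg A) (fun i : 'I_m => u i) P.

Definition alg_independent (F : fieldType) (A : comAlgType F) (u : nat -> A) :
    Prop :=
  forall (m : nat) (P : {mpoly F[m]}), peval u P = 0 -> P = 0.

Definition generates (F : fieldType) (A : comAlgType F) (u : nat -> A)
    (B : {pred A}) : Prop :=
  forall x : A, x \in B <-> exists (m : nat) (P : {mpoly F[m]}), x = peval u P.

(* Main.v *)
Require Import Defs.
From HB Require Import structures.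
From mathcomp Require Import all_boot all_order all_algebra.
From mathcomp Require Import fingroup perm boolp.
From mathcomp Require Import mpoly ring zify.

Set Implicit Arguments.
Unset Strict Implicit.
Unset Printing Implicit Defensive.

Import GRing.Theory.
Local Open Scope ring_scope.

(** If every [lam n] is a hook, Pieri's rule
    [h_(a+1) e_(b+1) = s_(a+1, 1^(b+1)) + s_(a+2, 1^b)] shows that a hook Schur
    function of degree [n] is [+- e_n] plus a polynomial in [e_1, ..., e_(n-1)],
    so the claim follows from the fundamental theorem on symmetric functions.

    Conversely, the number of semistandard tableaux of shape [lam] with entries
    below [k] is a polynomial [N_lam] in [k].  Setting [k] variables to [t] and
    the others to 0, a polynomial expression of the power sum [p_n] in the
    [s_(lam j)] becomes an expression of [K t^n] in the [N_(lam j)(K) t^j];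
    comparing the terms linear in [K] gives [N_(lam n)'(0) != 0].  But if
    [lam n] is not a hook this derivative vanishes: by symmetry, [n N(k+1)] is
    [k+1] times the total number of occurrences of the largest letter, i.e.
    [\sum_B #|lam / B| N_B(k)] over the horizontal strips [lam / B]; at [k = -1]
    only single columns [B] have [N_B(-1) != 0], and removing a horizontal strip
    from a shape that is not a hook never leaves a single column. *)

(** * Evaluation of polynomials, and subalgebras generated by initial segments of a sequence *)

Lemma mpoly_morph_ext (R : fieldType) (A : comNzRingType) (n : nat)
    (f g : {rmorphism {mpoly R[n]} -> A}) :
  (forall c, f c%:MP = g c%:MP) -> (forall i, f 'X_i = g 'X_i) -> f =1 g.
Proof.
move=> fgC fgX p; elim/mpolyind: p => [|c m p _ _ IH]; first by rewrite !rmorph0.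
rewrite !rmorphD IH; congr (_ + _).
rewrite -mul_mpolyC !rmorphM fgC mpolyXE_id !rmorph_prod; congr (_ * _).
by apply: eq_bigr => i _; rewrite !rmorphXn fgX.
Qed.

Section Peval.
Variables (F : fieldType) (A : comAlgType F).
Implicit Types (u v : nat -> A) (x y : A).

HB.instance Definition _ u m :=
  GRing.RMorphism.copy (@peval F A u m) (mmap (in_alg A) (fun i : 'I_m => u i)).

Lemma pevalC u m c : peval u (c%:MP : {mpoly F[m]}) = c%:A.
Proof. exact: mmapC. Qed.

Lemma pevalX u m (i : 'I_m) : peval u ('X_i : {mpoly F[m]}) = u i.
Proof. by rewrite /peval mmapX mmap1U. Qed.

Lemma pevalZ u m c (P : {mpoly F[m]}) : peval u (c *: P) = c *: peval u P.
Proof. by rewrite /peval mmapZ mulr_algl. Qed.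

Lemma eq_peval u v m (P : {mpoly F[m]}) :
  (forall i, (i < m)%N -> u i = v i) -> peval u P = peval v P.
Proof.
move=> uv.
apply: (@mpoly_morph_ext F A m (@peval F A u m) (@peval F A v m)) => [c|i] /=.
  by rewrite !pevalC.
by rewrite !pevalX uv.
Qed.

End Peval.

Section Generation.
Variables (F : fieldType) (A : comAlgType F).
Implicit Types (u v : nat -> A) (x y : A).

Lemma peval_comp u m k (Q : nat -> {mpoly F[k]}) (P : {mpoly F[m]}) :
  peval u (peval Q P) = peval (fun i => peval u (Q i)) P.
Proof.
apply: (@mpoly_morph_ext F A m (@peval F A u k \o @peval F _ Q m)
  (@peval F A _ m)) => [c|i] /=.
  by rewrite !pevalC pevalZ rmorph1.
by rewrite !pevalX.
Qed.

(** The explicit bound [m] records which generators may occur; triangularity depends on it. *)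
Definition gen_in u m x := exists P : {mpoly F[m]}, x = peval u P.

Lemma gen_in1 u m : gen_in u m 1. Proof. by exists 1; rewrite rmorph1. Qed.

Lemma gen_inX u m i : (i < m)%N -> gen_in u m (u i).
Proof. by move=> lt_im; exists 'X_(Ordinal lt_im); rewrite pevalX. Qed.

Lemma gen_inD u m x y : gen_in u m x -> gen_in u m y -> gen_in u m (x + y).
Proof. by move=> [P ->] [Q ->]; exists (P + Q); rewrite rmorphD. Qed.

Lemma gen_inM u m x y : gen_in u m x -> gen_in u m y -> gen_in u m (x * y).
Proof. by move=> [P ->] [Q ->]; exists (P * Q); rewrite rmorphM. Qed.

Lemma gen_inZ u m c x : gen_in u m x -> gen_in u m (c *: x).
Proof. by case=> P ->; exists (c *: P); rewrite pevalZ. Qed.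

Lemma gen_in_peval u v m k (P : {mpoly F[m]}) :
  (forall i, (i < m)%N -> gen_in u k (v i)) -> gen_in u k (peval v P).
Proof.
move=> uv.
have uvE i : exists Q : {mpoly F[k]}, (i < m)%N -> v i = peval u Q.
  by case: ltnP => [/uv[Q ->]|_]; [exists Q | exists 0].
have [Q Qv] := choice uvE.
by exists (peval Q P); rewrite peval_comp; apply: eq_peval => i /Qv.
Qed.

Lemma gen_in_trans u v m k x : gen_in v m x ->
  (forall i, (i < m)%N -> gen_in u k (v i)) -> gen_in u k x.
Proof. by case=> P -> uv; apply: gen_in_peval. Qed.

Lemma gen_in_widen u m k x : (m <= k)%N -> gen_in u m x -> gen_in u k x.
Proof.
move=> le_mk um; apply: (gen_in_trans um) => i lt_im.
exact/gen_inX/(leq_trans lt_im).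
Qed.

(** Only finitely many [v i] occur, so the maximum of their bounds serves for all of them. *)
Lemma gen_by_trans u v m x : gen_in v m x ->
  (forall i, exists k, gen_in u k (v i)) -> exists k, gen_in u k x.
Proof.
move=> vx /choice[K uK]; exists (\max_(i < m) K i).
apply: (gen_in_trans vx) => i lt_im; apply: gen_in_widen (uK i).
exact: (leq_bigmax (Ordinal lt_im)).
Qed.

(** The analogue of an invertible triangular matrix, with polynomial instead of linear entries below
    the diagonal. *)
Definition triangular u v m := forall n, (n < m)%N ->
  exists c x, [/\ c != 0, gen_in v n x & u n = c *: v n + x].

(** Solve for [v n]: the remainder involves only [v i] with [i < n], which by strong induction are
    polynomials in the [u j] with [j <= i]. *)
Lemma triangular_sym u v m : triangular u v m -> triangular v u m.
Proof.
move=> uv n; elim/ltn_ind: n => n IHn lt_nm.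
have [c [x [nz_c vx un]]] := uv n lt_nm.
exists c^-1, (- c^-1 *: x); split; first by rewrite invr_eq0.
  apply/gen_inZ/(gen_in_trans vx) => i lt_in.
  have [d [y [_ uy ->]]] := IHn i lt_in (ltn_trans lt_in lt_nm).
  apply: gen_inD; first exact/gen_inZ/gen_inX.
  exact: gen_in_widen (ltnW lt_in) uy.
by rewrite un scalerDr scalerA mulVf // scale1r scaleNr addrK.
Qed.

Lemma triangular_gen u v m n :
  (n < m)%N -> triangular u v m -> gen_in v m (u n).
Proof.
move=> lt_nm uv; have [c [x [_ vx ->]]] := uv n lt_nm.
apply: gen_inD; first exact/gen_inZ/gen_inX.
exact: gen_in_widen (ltnW lt_nm) vx.
Qed.

End Generation.

(** * Triangular substitutions and algebraic independence *)

(** The variables as a sequence indexed by all of [nat], with default 0 from [m] on, so that [peval]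
    and [triangular] apply to them. *)
Definition coord (F : fieldType) (m i : nat) : {mpoly F[m]} :=
  oapp (fun j : 'I_m => 'X_j) 0 (insub i).

Lemma peval_coord (F : fieldType) (A : comAlgType F) (u : nat -> A) m i :
  (i < m)%N -> peval u (coord F m i) = u i.
Proof. by move=> lt_im; rewrite /coord insubT /= pevalX. Qed.

Lemma peval_coordE (F : fieldType) m k (P : {mpoly F[k]}) :
  (k <= m)%N -> forall (A : comAlgType F) (u : nat -> A),
  peval u (peval (coord F m) P) = peval u P.
Proof.
move=> le_km A u; rewrite peval_comp; apply: eq_peval => i lt_ik.
exact/peval_coord/(leq_trans lt_ik).
Qed.

Lemma peval_coord_id (F : fieldType) m (P : {mpoly F[m]}) :
  peval (coord F m) P = P.
Proof.
apply: (@mpoly_morph_ext F _ m (@peval F _ (coord F m) m) idfun) => [c|i] /=.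
  by rewrite pevalC -mul_mpolyC mulr1.
by rewrite pevalX /coord valK.
Qed.

(** Lifts the triangular relations from [A] to the polynomial ring, where the coordinates that stand
    for [v] satisfy no relation. *)
Lemma triangular_subst (F : fieldType) (A : comAlgType F) (u v : nat -> A) m :
  triangular u v m -> exists phi : nat -> {mpoly F[m]},
    triangular phi (coord F m) m /\
    forall n, (n < m)%N -> peval v (phi n) = u n.
Proof.
set X := coord F m => uv.
have phiE n : exists phi : {mpoly F[m]}, (n < m)%N ->
    (exists c x, [/\ c != 0, gen_in X n x & phi = c *: X n + x])
    /\ peval v phi = u n.
  case: (ltnP n m) => [lt_nm|_]; last by exists 0.
  have [c [_ [nz_c [Q ->] unE]]] := uv n lt_nm.
  have XQ : gen_in X n (peval X Q) by exists Q.
  exists (c *: X n + peval X Q) => _; split; first by exists c, (peval X Q).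
  by rewrite unE rmorphD /= pevalZ peval_coord // peval_coordE // ltnW.
have [phi phiP] := choice phiE; exists phi.
by split=> n /phiP[].
Qed.

(* phi is the substitution turning coordinates into u.  Triangular
   substitutions are onto; so phi has a section w, again triangular, hence
   onto as well, and phi is injective. *)
Lemma triangular_indep (F : fieldType) (A : comAlgType F) (u v : nat -> A) :
  (forall m, triangular u v m) -> alg_independent v -> alg_independent u.
Proof.
move=> uv indep_v m P uP0.
have [phi [phiX phiP]] := triangular_subst (uv m).
have [w [wX wP]] := triangular_subst (triangular_sym phiX).
have [R RP] : gen_in w m P.
  rewrite -[P]peval_coord_id; apply: gen_in_peval => i lt_im.
  exact: triangular_gen lt_im (triangular_sym wX).
have R0 : peval phi P = R.
  rewrite RP peval_comp -[RHS]peval_coord_id.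
  by apply: eq_peval => i /wP.
suffices phiP0 : peval phi P = 0 by rewrite RP -R0 phiP0 rmorph0.
apply: indep_v; rewrite peval_comp -[RHS]uP0.
by apply: eq_peval => i /phiP.
Qed.

(** * Setting the last variable to 0 *)

Section Restriction.
Variable F : fieldType.

Fact restrict_last_additive N : additive (@restrict_last F N).
Proof. exact: comp_mpoly_is_additive. Qed.
Fact restrict_last_multiplicative N : multiplicative (@restrict_last F N).
Proof. exact: comp_mpoly_is_multiplicative. Qed.
HB.instance Definition _ N :=
  GRing.isAdditive.Build _ _ _ (@restrict_last_additive N).
HB.instance Definition _ N :=
  GRing.isMultiplicative.Build _ _ _ (@restrict_last_multiplicative N).

Lemma restrict_lastZ N c (p : {mpoly F[N.+1]}) :
  restrict_last (c *: p) = c *: restrict_last p.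
Proof. by rewrite /restrict_last comp_mpolyZ. Qed.

Lemma restrict_lastXmax N : restrict_last ('X_ord_max : {mpoly F[N.+1]}) = 0.
Proof.
by rewrite /restrict_last comp_mpolyXU -tnth_nth tnth_mktuple unlift_none.
Qed.

Lemma restrict_lastXlift N (i : 'I_N) :
  restrict_last ('X_(lift ord_max i) : {mpoly F[N.+1]}) = 'X_i.
Proof.
by rewrite /restrict_last comp_mpolyXU -tnth_nth tnth_mktuple liftK.
Qed.

Lemma widen_lift_max N (i : 'I_N) : mnmwiden U_(i) = U_(lift ord_max i)%MM.
Proof.
by rewrite mnmwiden1; congr U_(_)%MM; apply/val_inj; rewrite /= /bump leqNgt ltn_ord.
Qed.

Lemma restrict_mwiden N (p : {mpoly F[N]}) : restrict_last (mwiden p) = p.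
Proof.
apply: (@mpoly_morph_ext F _ N (@restrict_last F N \o @mwiden N F) idfun).
  by move=> c /=; rewrite mwidenC /restrict_last comp_mpolyC.
by move=> i /=; rewrite mwidenX widen_lift_max restrict_lastXlift.
Qed.

Lemma restrict_mesym N n :
  restrict_last (mesym N.+1 F n) = mesym N F n.
Proof.
case: n => [|n]; first by rewrite !mesym0E rmorph1.
rewrite mesymSS rmorphD rmorphM /= !restrict_mwiden.
by rewrite restrict_lastXmax mulr0 addr0.
Qed.

Definition mnm_last0 N (m : 'X_{1..N.+1}) := [multinom m (lift ord_max i) | i < N].

Lemma restrict_lastX N (m : 'X_{1..N.+1}) :
  restrict_last 'X_[m] =
    (m ord_max == 0%N)%:R *: 'X_[mnm_last0 m] :> {mpoly F[N]}.
Proof.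
rewrite mpolyXE_id rmorph_prod big_ord_recr /= rmorphXn /= restrict_lastXmax.
rewrite expr0n mulrC -mul_mpolyC rmorph_nat [in RHS]mpolyXE_id.
congr (_ * _); apply: eq_bigr => i _.
have -> : widen_ord (leqnSn N) i = lift ord_max i.
  by apply/val_inj; rewrite /= /bump leqNgt ltn_ord.
by rewrite rmorphXn /= restrict_lastXlift mnmE.
Qed.

(** Monomials free of the last variable stay distinct under restriction, and all the others are
    killed. *)
Lemma mcoeff_restrict_last N (p : {mpoly F[N.+1]}) (m : 'X_{1..N.+1}) :
  m ord_max = 0%N -> (restrict_last p)@_(mnm_last0 m) = p@_m.
Proof.
move=> m0; rewrite [p in RHS]mpolyE [p in LHS]mpolyE.
rewrite (raddf_sum (@restrict_last F N)) !(raddf_sum (mcoeff _)) /=.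
apply: eq_bigr => k _.
rewrite restrict_lastZ restrict_lastX !mcoeffZ !mcoeffX; congr (_ * _).
have [k0|nz_k] := eqVneq (k ord_max) 0%N; last first.
  rewrite mul0r; case: eqP => // km.
  by rewrite km m0 eqxx in nz_k.
rewrite mul1r; congr (_%:R); congr nat_of_bool.
apply/eqP/eqP => [km|->//]; apply/mnmP => i.
case: (unliftP ord_max i) => [j ->|->]; last by rewrite k0.
by move/mnmP/(_ j): km; rewrite !mnmE.
Qed.

(* Every monomial of p involves the last variable, hence all of them. *)
Lemma symmetric_restrict_eq0 N (p : {mpoly F[N.+1]}) :
  p \is symmetric -> restrict_last p = 0 -> (msize p <= N.+1)%N -> p = 0.
Proof.
move=> sym_p p0 size_p; apply/eqP; apply/negPn/negP => nz_p.
have lead_p := mlead_supp nz_p; set m := mlead p in lead_p.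
have m_gt0 i : (0 < m i)%N.
  rewrite lt0n; apply/eqP => mi0.
  have := lead_p; rewrite -(issym_msupp (tperm i ord_max)) //.
  rewrite mcoeff_msupp -mcoeff_restrict_last; last by rewrite mnmE tpermR.
  by rewrite p0 mcoeff0 eqxx.
(* [msize] exceeds the degree by one, so the degree is at most [N], whereas all [N.+1] exponents are
   positive. *)
have := leq_trans (msize_mdeg_lt lead_p) size_p.
rewrite ltnS leqNgt => /negP[]; rewrite mdegE -{1}[N.+1]card_ord -sum1_card.
exact: leq_sum.
Qed.

End Restriction.

(** * Elementary symmetric functions are free generators of [Lambda F] *)

Section Elementary.
Variable F : fieldType.

(** The projection to [N] variables gets a name in order to carry the structure of a ring
    morphism. *)
Definition fam_at N (f : mpfam F) : {mpoly F[N]} := f N.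

Fact fam_at_additive N : additive (fam_at N). Proof. by []. Qed.
Fact fam_at_multiplicative N : multiplicative (fam_at N). Proof. by []. Qed.
HB.instance Definition _ N := GRing.isAdditive.Build _ _ _ (@fam_at_additive N).
HB.instance Definition _ N :=
  GRing.isMultiplicative.Build _ _ _ (@fam_at_multiplicative N).

Lemma peval_at (u : nat -> mpfam F) m (P : {mpoly F[m]}) N :
  fam_at N (peval u P) = peval (fun i => fam_at N (u i)) P.
Proof.
apply: (@mpoly_morph_ext F _ m (@fam_at N \o @peval F _ u m)
  (@peval F _ (fun i => fam_at N (u i)) m)) => [c|i] /=.
  by rewrite !pevalC.
by rewrite !pevalX.
Qed.

Lemma msize_homog N d (p : {mpoly F[N]}) :
  p \is d.-homog -> (msize p <= d.+1)%N.
Proof.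
move=> /dhomog_mf hom_p; rewrite msizeE big_seq; apply/bigmax_leqP_seq => m.
by move=> /hom_p + _; rewrite ltnS => ->.
Qed.

(** The shift by one leaves out [e_0 = 1], which would destroy independence. *)
Definition elem_fam n : mpfam F := fun N => mesym N F n.+1.

Lemma elem_Lambda n : elem_fam n \in Lambda F.
Proof.
apply/asboolP; split=> [N|N|]; first exact: mesym_sym.
  exact: restrict_mesym.
by exists n.+2 => N; apply/msize_homog/dhomog_mesym.
Qed.

Lemma comp_mpoly_peval m k (t : m.-tuple {mpoly F[k]}) (P : {mpoly F[m]}) :
  P \mPo t = peval (fun i => t`_i) P.
Proof.
apply: (@mpoly_morph_ext F _ m (@comp_mpoly m F k t)
  (@peval F _ (fun i => t`_i) m)) => [c|i] /=.
  by rewrite comp_mpolyC pevalC -mul_mpolyC mulr1.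
by rewrite comp_mpolyXU pevalX.
Qed.

Lemma elem_comp m (P : {mpoly F[m]}) :
  P \mPo [tuple mesym m F i.+1 | i < m] = fam_at m (peval elem_fam P).
Proof.
rewrite comp_mpoly_peval peval_at; apply: eq_peval => i lt_im.
by rewrite (nth_mktuple _ _ (Ordinal lt_im)).
Qed.

(** A relation among the first [m] members is already refuted in [m] variables, by the fundamental
    theorem on symmetric polynomials. *)
Lemma elem_indep : alg_independent elem_fam.
Proof.
move=> m P Pe0; apply: (@msym_fundamental_un0 m).
by rewrite elem_comp Pe0.
Qed.

Lemma homog_prodX N k (p : 'I_k -> {mpoly F[N]}) (w e : 'I_k -> nat) :
  (forall i, p i \is (w i).-homog) ->
  \prod_(i < k) p i ^+ e i \is (\sum_(i < k) w i * e i)%N.-homog.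
Proof.
move=> hom_p; apply: (big_rec2 (fun d (q : {mpoly F[N]}) => q \is d.-homog)).
  exact: dhomog1.
by move=> i d q _ hom_q; apply: dhomogM => //; apply: dhomogMn.
Qed.

(** The bound is uniform in [N]: [e_(i+1)] is homogeneous of degree [i+1] in any number of
    variables, and [i+1] is the weight of variable [i] in [mweight]. *)
Lemma msize_peval_elem m (P : {mpoly F[m]}) N :
  (msize (fam_at N (peval elem_fam P)) <= mweight P)%N.
Proof.
rewrite peval_at {1}[P]mpolyE rmorph_sum /=.
apply: leq_trans (mmeasure_sum _ _ _ _) _.
apply/bigmax_leqP_seq => k Pk _; rewrite pevalZ mpolyXE_id rmorph_prod.
apply: leq_trans (msizeZ_le _ _) _.
rewrite (eq_bigr (fun i : 'I_m => mesym N F i.+1 ^+ k i)); last first.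
  by move=> i _; rewrite rmorphXn /= pevalX.
apply: leq_trans (msize_homog (homog_prodX _ (fun i => dhomog_mesym N F _))) _.
apply: leq_trans (mmeasure_mnm_lt _ Pk).
by rewrite ltnS /mnmwgt; apply: leq_sum => i _; rewrite mulnC.
Qed.

Lemma peval_Lambda (u : nat -> mpfam F) m (P : {mpoly F[m]}) :
  (forall n, u n \in Lambda F) -> peval u P \in Lambda F.
Proof.
move=> uL; rewrite /peval /mmap; apply: rpred_sum => k _.
rewrite mulr_algl; apply/rpredZ/rpred_prod => i _.
exact: rpredX.
Qed.

(** Take [d] bounding all sizes and apply the fundamental theorem in [d] variables. The difference
    [g] then vanishes in [d] variables, in fewer by restriction, and in more because a symmetric
    polynomial of small degree is determined by its restriction. *)
Lemma Lambda_gen_elem (f : mpfam F) :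
  f \in Lambda F -> exists d, gen_in elem_fam d f.
Proof.
move=> fL; have /asboolP[sym_f rest_f [d size_f]] := fL.
have [t [tf le_t]] := sym_fundamental (sym_f d).
exists d, t; apply/eqP; rewrite -subr_eq0; apply/eqP.
set g := f - _.
have : g \in Lambda F by rewrite rpredB // peval_Lambda // => n; apply: elem_Lambda.
move=> /asboolP[sym_g rest_g _].
have size_g N : (msize (g N) <= d)%N.
  apply: leq_trans (msizeD_le _ _) _; rewrite geq_max size_f msizeN.
  apply: leq_trans (msize_peval_elem _ _) _.
  exact: leq_trans le_t (size_f d).
have g_d : g d = 0.
  by apply/eqP; rewrite subr_eq0 -[f d]tf elem_comp.
have g_below k : g (d - k)%N = 0.
  elim: k => [|k IHk]; first by rewrite subn0.
  have [le_dk|lt_kd] := leqP d k.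
    have /eqP d_k : (d - k == 0)%N by rewrite subn_eq0.
    have /eqP -> : (d - k.+1 == 0)%N by rewrite subn_eq0 leqW.
    by rewrite -d_k.
  by rewrite -rest_g; move: IHk; rewrite -(subnSK lt_kd) => ->; rewrite rmorph0.
have g_above k : g (d + k)%N = 0.
  elim: k => [|k IHk]; first by rewrite addn0.
  rewrite addnS; apply: symmetric_restrict_eq0; first exact: sym_g.
    by rewrite rest_g.
  by rewrite (leq_trans (size_g _)) // -addnS leq_addr.
apply: mpfamP => N; have [le_dN|lt_Nd] := leqP d N.
  by rewrite -(subnKC le_dN) g_above.
by rewrite -(subKn (ltnW lt_Nd)) g_below.
Qed.

End Elementary.

(** * Hook Schur functions as sums over words, and Pieri's rule *)

Section HookWords.
Variable F : fieldType.

(* Words read along the hook (n - b, 1^b), from the foot of the leg up to the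
   corner, which is letter number b, and then along the arm. *)
Definition hook_word n b N (w : {ffun 'I_n -> 'I_N}) : bool :=
  [forall i : 'I_n, forall j : 'I_n, (i < j)%N ==>
     ((j <= b)%N ==> (w j < w i)%N) && ((b <= i)%N ==> (w i <= w j)%N)].

(** For [b < n] this is the Schur function of the hook [(n - b, 1^b)]; thus [b = n - 1] gives [e_n]
    and [b = 0] gives [h_n]. *)
Definition hook_sum n b : mpfam F :=
  fun N => \sum_(w : {ffun 'I_n -> 'I_N} | hook_word b w) \prod_i 'X_(w i).

Lemma hook_wordP n b N (w : {ffun 'I_n -> 'I_N}) :
  reflect (forall i j : 'I_n, (i < j)%N ->
     ((j <= b)%N -> (w j < w i)%N) /\ ((b <= i)%N -> (w i <= w j)%N))
    (hook_word b w).
Proof.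
apply: (iffP forallP) => [w_b i j lt_ij|w_b i].
  have /forallP/(_ j) := w_b i; rewrite lt_ij.
  by case/andP=> /implyP ? /implyP.
apply/forallP => j; apply/implyP => /w_b[dec inc].
by apply/andP; split; apply/implyP.
Qed.

(** Concatenate a strictly decreasing word with a weakly increasing one. If the word descends at the
    junction, the leg continues to the first letter of the second word; otherwise the corner is the
    last letter of the first word. *)
Lemma hook_sumM m k : hook_sum m.+1 m * hook_sum k.+1 0 =
  hook_sum (m.+1 + k.+1) m.+1 + hook_sum (m.+1 + k.+1) m.
Proof.
apply: mpfamP => N.
pose left (w : {ffun 'I_(m.+1 + k.+1) -> 'I_N}) : {ffun 'I_m.+1 -> 'I_N} :=
  [ffun i => w (lshift k.+1 i)].
pose right (w : {ffun 'I_(m.+1 + k.+1) -> 'I_N}) : {ffun 'I_k.+1 -> 'I_N} :=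
  [ffun i => w (rshift m.+1 i)].
pose join (p : {ffun 'I_m.+1 -> 'I_N} * {ffun 'I_k.+1 -> 'I_N}) :=
  [ffun i => match split i with inl j => p.1 j | inr j => p.2 j end].
have joinK : cancel (fun w => (left w, right w)) join.
  move=> w; apply/ffunP => i; rewrite ffunE -{2}[i]splitK.
  by case: split => j; rewrite ffunE.
have cutK : cancel join (fun w => (left w, right w)).
  move=> [u v]; congr pair; apply/ffunP => i; rewrite !ffunE.
    by rewrite (unsplitK (inl i)).
  by rewrite (unsplitK (inr i)).
have -> : (hook_sum m.+1 m * hook_sum k.+1 0) N =
    \sum_(w : {ffun 'I_(m.+1 + k.+1) -> 'I_N} |
        hook_word m (left w) && hook_word 0 (right w)) \prod_i 'X_(w i).
  rewrite -[LHS]/(_ * _) /hook_sum big_distrlr pair_big /=.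
  rewrite (reindex (fun w => (left w, right w))) /=; last first.
    by exists join => w _; [apply: joinK | apply: cutK].
  apply: eq_bigr => w _; rewrite [RHS]big_split_ord /=.
  by congr (_ * _); apply: eq_bigr => i _; rewrite ffunE.
pose i0 : 'I_(m.+1 + k.+1) := lshift k.+1 ord_max.
pose j0 : 'I_(m.+1 + k.+1) := rshift m.+1 ord0.
rewrite (bigID (fun w : {ffun 'I_(m.+1 + k.+1) -> 'I_N} => (w j0 < w i0)%N)) /=.
(* The condition on the two halves, stated for the whole word: it does not compare letter [m] with
   letter [m.+1]. *)
have cutP (w : {ffun 'I_(m.+1 + k.+1) -> 'I_N}) : reflect
    (forall i j : 'I_(m.+1 + k.+1), (i < j)%N ->
     ((j <= m)%N -> (w j < w i)%N) /\ ((m < i)%N -> (w i <= w j)%N))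
    (hook_word m (left w) && hook_word 0 (right w)).
  apply: (iffP andP) => [[/hook_wordP lw /hook_wordP rw] i j lt_ij|cut_w].
    split=> [le_jm|lt_mi].
      have lt_im := ltn_trans lt_ij (le_jm : (j < m.+1)%N).
      have [/(_ le_jm) + _] :=
        lw (Ordinal lt_im) (Ordinal (le_jm : (j < m.+1)%N)) lt_ij.
      by rewrite !ffunE; congr (w _ < w _)%N; apply: val_inj.
    have lt_k (l : 'I_(m.+1 + k.+1)) : (m < l)%N -> (l - m.+1 < k.+1)%N.
      by move=> lt_ml; rewrite ltn_subLR.
    have lt_mj := ltn_trans lt_mi lt_ij.
    have lt_ij' : (i - m.+1 < j - m.+1)%N 
      by rewrite ltn_sub2r ?(leq_ltn_trans lt_mi).
    have [_ /(_ isT)] :=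
      rw (Ordinal (lt_k i lt_mi)) (Ordinal (lt_k j lt_mj)) lt_ij'.
    by rewrite !ffunE; congr (w _ <= w _)%N; apply: val_inj; rewrite /= subnKC.
  split; apply/hook_wordP => i j lt_ij; rewrite !ffunE.
    split=> [le_jm|le_mi]; first by apply cut_w.
    by have := leq_ltn_trans le_mi lt_ij; rewrite ltnNge -ltnS ltn_ord.
  split=> [|_]; first by rewrite leqNgt (leq_ltn_trans _ lt_ij).
  by apply cut_w; rewrite /= ?ltn_add2l // leq_addr.
congr (_ + _); apply: eq_bigl => w.
  apply/andP/hook_wordP => [[/cutP cut_w lt_w] i j lt_ij|hook_w].
    split=> [|lt_mi]; last by apply cut_w.
    rewrite leq_eqVlt => /predU1P[jE|lt_jm]; last by apply cut_w.
    have -> : j = j0 by apply: val_inj; rewrite /= jE addn0.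
    have : (i <= m)%N by move: lt_ij; rewrite jE.
    rewrite leq_eqVlt => /predU1P[iE|lt_im].
      by have -> : i = i0 by apply: val_inj.
    by apply: ltn_trans lt_w _; apply cut_w.
  split; last by apply hook_w; rewrite /= addn0.
  by apply/cutP => i j lt_ij; split=> ?; apply hook_w => //; apply: leqW.
apply/andP/hook_wordP => [[/cutP cut_w le_w] i j lt_ij|hook_w].
  rewrite -leqNgt in le_w.
  split=> [le_jm|]; first by apply cut_w.
  rewrite leq_eqVlt => /predU1P[iE|lt_mi]; last by apply cut_w.
  have -> : i = i0 by apply: val_inj.
  have : (m < j)%N by move: lt_ij; rewrite -iE.
  rewrite leq_eqVlt => /predU1P[jE|lt_mj].
    by have -> : j = j0 by apply: val_inj; rewrite /= -jE addn0.
  by apply: leq_trans le_w _; apply cut_w; rewrite /= addn0.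
split; last by rewrite -leqNgt; apply hook_w; rewrite /= ?addn0.
by apply/cutP => i j lt_ij; split=> ?; apply hook_w => //; apply: ltnW.
Qed.

(** With the corner at the last letter there is no arm; read backwards, the words are the strictly
    increasing tuples that index the monomials of [e_(n+1)]. *)
Lemma hook_sum_column n : hook_sum n.+1 n = elem_fam F n.
Proof.
apply: mpfamP => N; rewrite /hook_sum /elem_fam mesym_tupleE.
rewrite (reindex (fun h : n.+1.-tuple 'I_N => [ffun i => tnth h (rev_ord i)]));
  last first.
  exists (fun w : {ffun 'I_n.+1 -> 'I_N} => [tuple w (rev_ord i) | i < n.+1]) =>
    [h _|w _].
    by apply: eq_from_tnth => i; rewrite tnth_mktuple ffunE rev_ordK.
  by apply/ffunP => i; rewrite ffunE tnth_mktuple rev_ordK.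
apply: eq_big => [h|h _]; last first.
  rewrite big_tuple (reindex_inj rev_ord_inj) /=.
  by apply: eq_bigr => i _; rewrite ffunE rev_ordK.
have nthE (i : 'I_n.+1) : nth 0%N (map val h) i = tnth h i.
  by rewrite (nth_map (tnth h i)) ?size_tuple // -tnth_nth.
apply/hook_wordP/idP => [hook_h|].
  apply/(sortedP 0%N) => i; rewrite size_map size_tuple => lt_in.
  have := nthE (Ordinal lt_in); rewrite /= => ->.
  have := nthE (Ordinal (ltnW lt_in)); rewrite /= => ->.
  pose i1 := rev_ord (Ordinal lt_in); pose i2 := rev_ord (Ordinal (ltnW lt_in)).
  have lt12 : (i1 < i2)%N by rewrite /= ltn_sub2l.
  have [+ _] := hook_h i1 i2 lt12; rewrite !ffunE !rev_ordK; apply.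
  by rewrite -ltnS.
rewrite /tmono => sorted_h i j lt_ij; rewrite !ffunE -!nthE; split=> [_|le_ni].
  apply: (sorted_ltn_nth ltn_trans) => //; rewrite ?inE ?size_map ?size_tuple //.
  by rewrite /= ltn_sub2l // ltnS (leq_trans lt_ij) // -ltnS.
by have := leq_ltn_trans le_ni lt_ij; rewrite ltnNge -ltnS ltn_ord.
Qed.

End HookWords.

(** * Cells of Young diagrams, and hook tableaux as words *)

Section Cells.
Variable s : seq nat.

Definition mkcell r k (lt_r : (r < size s)%N) (lt_k : (k < nth 0 s r)%N) : cell s :=
  Tagged (fun i : 'I_(size s) => 'I_(nth 0%N s i))
    (Ordinal (lt_k : (k < nth 0 s (Ordinal lt_r))%N)).

Lemma cell_eqP (c d : cell s) :
  cell_row c = cell_row d -> cell_col c = cell_col d -> c = d.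
Proof.
case: c d => [i x] [j y]; rewrite /cell_row /cell_col /= => /val_inj ij.
by case: j / ij y => y /val_inj ->.
Qed.

Lemma cell_row_lt (c : cell s) : (cell_row c < size s)%N.
Proof. exact: ltn_ord. Qed.

Lemma cell_col_lt (c : cell s) : (cell_col c < nth 0 s (cell_row c))%N.
Proof. exact: ltn_ord. Qed.

Lemma ex_cell r k : (r < size s)%N -> (k < nth 0 s r)%N ->
  exists c : cell s, cell_row c = r /\ cell_col c = k.
Proof. by move=> lt_r lt_k; exists (mkcell lt_r lt_k). Qed.

End Cells.

Section HookSchur.
Variables (F : fieldType) (a b : nat).
Let hook := a.+1 :: nseq b 1%N.
Implicit Types c d : cell hook.

Lemma hook_row_le c : (cell_row c <= b)%N.
Proof. by have := cell_row_lt c; rewrite /= size_nseq. Qed.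

Lemma hook_col_leg c : (0 < cell_row c)%N -> cell_col c = 0%N.
Proof.
have := cell_col_lt c; case: (cell_row c) (hook_row_le c) => //= r lt_rb.
by rewrite nth_nseq lt_rb ltnS leqn0 => /eqP.
Qed.

Lemma hook_col_le c : (cell_col c <= a)%N.
Proof.
by have := cell_col_lt c; have [->|/hook_col_leg ->] // := posnP (cell_row c).
Qed.

Lemma schur_hook : schur F hook = hook_sum F (a + b).+1 b.
Proof.
(* The content of the cell shifted by [b]; the cells of a hook have distinct contents, so this is a
   bijection onto the positions of the word. *)
pose pos c := (b + cell_col c - cell_row c)%N.
have pos_lt c : (pos c < (a + b).+1)%N.
  rewrite ltnS; apply: leq_trans (leq_subr _ _) _.
  by rewrite addnC leq_add2r hook_col_le.
pose g c : 'I_(a + b).+1 := Ordinal (pos_lt c).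
(* Subtraction is truncated: positions up to [b] lie in column 0, and those from [b] on lie in row
   0. *)
have fP (i : 'I_(a + b).+1) :
    exists c, cell_row c = (b - i)%N /\ cell_col c = (i - b)%N.
  apply: ex_cell; rewrite /= ?size_nseq ?ltnS ?leq_subr //.
  have [le_bi|lt_ib] := leqP b i.
    rewrite (eqP (_ : b - i == 0)%N) ?subn_eq0 //= ltnS leq_subLR.
    by apply: leq_trans (eq_leq (addnC a b)); rewrite -ltnS.
  have /eqP -> : (i - b == 0)%N by rewrite subn_eq0 ltnW.
  by case: (b - i)%N (leq_subr i b) => //= r lt_rb; rewrite nth_nseq lt_rb.
have [f fE] := choice fP.
have gK : cancel f g.
  move=> i; have [row_f col_f] := fE i; apply: val_inj => /=.
  rewrite /pos row_f col_f; have [le_bi|lt_ib] := leqP b i.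
    by rewrite subnKC // (eqP (_ : b - i == 0)%N) ?subn_eq0 // subn0.
  have /eqP -> : (i - b == 0)%N by rewrite subn_eq0 ltnW.
  by rewrite addn0 subKn // ltnW.
have fK : cancel g f.
  move=> c; have [row_f col_f] := fE (g c).
  apply: cell_eqP; rewrite ?row_f ?col_f /= /pos.
    have [->|/hook_col_leg ->] := posnP (cell_row c); last first.
      by rewrite addn0 subKn // hook_row_le.
    by rewrite subn0; apply/eqP; rewrite subn_eq0 leq_addr.
  have [->|/hook_col_leg ->] := posnP (cell_row c); first by rewrite subn0 addKn.
  by rewrite addn0; apply/eqP; rewrite subn_eq0 leq_subr.
apply: mpfamP => N; rewrite /schur /hook_sum.
rewrite (reindex (fun w : {ffun 'I_(a + b).+1 -> 'I_N} => [ffun c => w (g c)]));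
  last first.
  exists (fun T : {ffun cell hook -> 'I_N} => [ffun i => T (f i)]) => T _;
    apply/ffunP => x; rewrite !ffunE.
    by rewrite gK.
  by rewrite fK.
apply: eq_big => [w|w _]; last first.
  rewrite (reindex f); last by exists g => ? _.
  by apply: eq_bigr => i _; rewrite ffunE gK.
apply/forallP/hook_wordP => [ssyt_w i j lt_ij|hook_w c].
  split=> [le_jb|le_bi].
    have /forallP/(_ (f i)) := ssyt_w (f j).
    have [-> ->] := fE i; have [-> ->] := fE j; rewrite !ffunE !gK => /andP[_].
    have le_ib := leq_trans (ltnW lt_ij) le_jb.
    have /eqP -> : (i - b == 0)%N by rewrite subn_eq0.
    have /eqP -> : (j - b == 0)%N by rewrite subn_eq0.
    move=> /implyP; apply=> /=.
    by rewrite ltn_sub2l // (leq_trans lt_ij).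
  have /forallP/(_ (f j)) := ssyt_w (f i).
  have [-> ->] := fE i; have [-> ->] := fE j; rewrite !ffunE !gK => /andP[+ _].
  have le_bj := leq_trans le_bi (ltnW lt_ij).
  have /eqP -> : (b - i == 0)%N by rewrite subn_eq0.
  have /eqP -> : (b - j == 0)%N by rewrite subn_eq0.
  move=> /implyP; apply=> /=.
  by rewrite leq_sub2r // ltnW.
apply/forallP => d; rewrite !ffunE; apply/andP; split; apply/implyP.
  case/andP=> /eqP row_cd; rewrite leq_eqVlt => /predU1P[col_cd|lt_cd].
    by rewrite (cell_eqP row_cd col_cd).
  have [row_c|/hook_col_leg] := posnP (cell_row d); last first.
    by move=> col_d; rewrite col_d in lt_cd.
  have lt_g : (g c < g d)%N.
    by rewrite /= /pos row_cd row_c !subn0 ltn_add2l.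
  have [_] := hook_w _ _ lt_g; apply.
  by rewrite /= /pos row_cd row_c subn0 leq_addr.
case/andP=> /eqP col_cd lt_cd.
have col_d := hook_col_leg (leq_ltn_trans (leq0n _) lt_cd).
have le_d := hook_row_le d.
have lt_g : (g d < g c)%N.
  by rewrite /= /pos col_cd col_d addn0 ltn_sub2l // (leq_trans lt_cd).
have [+ _] := hook_w _ _ lt_g; apply.
by rewrite /= /pos col_cd col_d addn0 leq_subr.
Qed.

End HookSchur.

(** * Hook Schur functions generate freely *)

Section Hooks.
Variable F : fieldType.

(* Pieri's rule h_(a+1) e_(b+1) = s_(a+1, 1^(b+1)) + s_(a+2, 1^b) moves one
   cell from the leg to the arm, up to sign and decomposable terms. *)
Lemma hook_sum_elem n a b : (a + b = n)%N -> exists c x,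
  [/\ c != 0, gen_in (elem_fam F) n x & hook_sum F n.+1 b = c *: elem_fam F n + x].
Proof.
elim/ltn_ind: n a b => n IHn a; elim: a => [|a IHa] b nE.
  exists 1, (0 *: 1); split; [exact: oner_neq0|exact/gen_inZ/gen_in1|].
  by rewrite -nE hook_sum_column scale1r scale0r addr0.
have [|c [x [nz_c ex hE]]] := IHa b.+1; first by rewrite addnS.
(* The factors are [e_(b+1)] and [h_(a+1)], both of degree at most [n]; the second is covered by the
   outer induction, and the hook with the longer leg by the inner one. *)
exists (- c), (hook_sum F b.+1 b * hook_sum F a.+1 0 - x).
split; first by rewrite oppr_eq0.
  rewrite -scaleN1r; apply: gen_inD; last exact: gen_inZ.
  have lt_bn : (b < n)%N by rewrite -nE addSn ltnS leq_addl.
  have lt_an : (a < n)%N by rewrite -nE addSn ltnS leq_addr.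
  apply: gen_inM; first by rewrite hook_sum_column; apply: gen_inX.
  have [d [y [_ ey ->]]] := IHn a lt_an a 0%N (addn0 a).
  by apply: gen_inD; [apply/gen_inZ/gen_inX | apply: gen_in_widen ey; apply: ltnW].
have -> : hook_sum F b.+1 b * hook_sum F a.+1 0 =
    hook_sum F n.+1 b.+1 + hook_sum F n.+1 b.
  by rewrite hook_sumM -nE addnC addSn addnS.
by rewrite hE scaleNr; ring.
Qed.

Lemma triangular_hooks (lam : nat -> seq nat) m :
  (forall n, is_part n (lam n)) -> (forall n, is_hook (lam n)) ->
  triangular (fun n => schur F (lam n.+1)) (elem_fam F) m.
Proof.
move=> lamP hook_lam n _; case: (hook_lam n.+1) => [lam0|[a [b [a_gt0 lamE]]]].
  by have /and3P[_ _] := lamP n.+1; rewrite lam0.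
case: a a_gt0 lamE => // a _ lamE.
have /and3P[_ _] := lamP n.+1; rewrite lamE /= sumn_nseq mul1n => /eqP[nE].
by rewrite schur_hook nE; apply: hook_sum_elem nE.
Qed.

End Hooks.

Section HookGeneration.
Variable F : fieldType.

Lemma hooks_generate (lam : nat -> seq nat) :
  (forall n, is_part n (lam n)) -> (forall n, is_hook (lam n)) ->
  alg_independent (fun n => schur F (lam n.+1)) /\
  generates (fun n => schur F (lam n)) (Lambda F).
Proof.
move=> lamP hook_lam.
have tri m := triangular_hooks F (m := m) lamP hook_lam.
split; first by apply: triangular_indep tri _; apply: elem_indep.
have uL n : schur F (lam n) \in Lambda F.
  case: n => [|n].
    have -> : lam 0%N = [::].
      have /and3P[_ nz_lam /eqP] := lamP 0%N.
      by case: (lam 0%N) nz_lam => [|[|k] l].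
    suff -> : schur F [::] = 1 by apply: rpred1.
    have no_cell (c : cell [::]) : False by case: c => -[].
    apply: mpfamP => N; rewrite /schur.
    pose T0 : {ffun cell [::] -> 'I_N} := [ffun c => False_rect _ (no_cell c)].
    rewrite (big_pred1 T0) => [|T]; first by rewrite big1 // => c; case: (no_cell c).
    by apply/forallP/eqP => [_|_ c]; [apply/ffunP => c|]; case: (no_cell c).
  have [P ->] := triangular_gen (ltnSn n) (tri n.+1).
  by apply: peval_Lambda => i; apply: elem_Lambda.
move=> f; split=> [fL|[m [P ->]]]; last exact: peval_Lambda.
have [d fd] := Lambda_gen_elem fL.
suff : exists m, gen_in (fun n => schur F (lam n)) m f.
  by case=> m [P fP]; exists m, P.
(* The bound is [i.+2] instead of [i.+1] because the generating family also contains index 0, which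
   the triangular family skips. *)
apply: gen_by_trans fd _ => i; exists i.+2.
have := triangular_gen (ltnSn i) (triangular_sym (tri i.+1)).
by move/gen_in_trans; apply=> j lt_ji; apply: (gen_inX (fun n => schur F (lam n))).
Qed.

End HookGeneration.

(** * Horizontal strips and the branching rule for fillings *)

Section Strips.
Variable s : seq nat.
Implicit Types (A B : {set cell s}) (c d : cell s).

(* A and B are shapes with A / B a horizontal strip. *)
Definition strip B A : bool :=
  [&& B \subset A,
      [forall c, forall d, (cell_row c == cell_row d) &&
         (cell_col c <= cell_col d)%N ==>
         ((d \in B) ==> (c \in B)) && ((d \in A) ==> (c \in A))]
    & [forall c, forall d, (cell_col c == cell_col d) &&
         (cell_row c < cell_row d)%N && (d \in A) ==> (c \in B)]].

(* Semistandard fillings of A in k letters, extended by the value k. *)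
Definition fillings k A : {set {ffun cell s -> 'I_k.+1}} :=
  [set T : {ffun cell s -> 'I_k.+1} |
    [forall c, (T c < k)%N == (c \in A)] &&
    [forall c, forall d,
       ((cell_row c == cell_row d) && (cell_col c <= cell_col d)%N
          ==> (T c <= T d)%N)
    && ((cell_col c == cell_col d) && (cell_row c < cell_row d)%N
          ==> (T c < T d)%N || (k <= T c)%N && (k <= T d)%N)]].

Lemma stripP B A : reflect
  [/\ forall c, c \in B -> c \in A,
      forall c d, cell_row c = cell_row d -> (cell_col c <= cell_col d)%N ->
        d \in B -> c \in B,
      forall c d, cell_row c = cell_row d -> (cell_col c <= cell_col d)%N ->
        d \in A -> c \in A
    & forall c d, cell_col c = cell_col d -> (cell_row c < cell_row d)%N ->
        d \in A -> c \in B]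
  (strip B A).
Proof.
apply: (iffP and3P) => [[/subsetP BA /forallP row /forallP col]|[BA rB rA col]].
  split=> // [c d rcd ccd|c d rcd ccd|c d ccd rcd dA].
  - have /forallP/(_ d) := row c; rewrite rcd eqxx ccd /=.
    by case/andP=> /implyP.
  - have /forallP/(_ d) := row c; rewrite rcd eqxx ccd /=.
    by case/andP=> _ /implyP.
  - by have /forallP/(_ d) := col c; rewrite ccd eqxx rcd dA.
split; first exact/subsetP.
  apply/forallP => c; apply/forallP => d; apply/implyP => /andP[/eqP rcd ccd].
  by apply/andP; split; apply/implyP; [apply: rB | apply: rA].
apply/forallP => c; apply/forallP => d.
by apply/implyP => /andP[/andP[/eqP ccd rcd]]; apply: col.
Qed.

Lemma fillingsP k A (T : {ffun cell s -> 'I_k.+1}) : reflect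
  [/\ forall c, (T c < k)%N = (c \in A),
      forall c d, cell_row c = cell_row d -> (cell_col c <= cell_col d)%N ->
        (T c <= T d)%N
    & forall c d, cell_col c = cell_col d -> (cell_row c < cell_row d)%N ->
        (T c < T d)%N \/ (k <= T c)%N /\ (k <= T d)%N]
  (T \in fillings k A).
Proof.
rewrite inE; apply: (iffP andP) => [[/forallP TA /forallP ssT]|[TA row col]].
  split=> [c|c d rcd ccd|c d ccd rcd]; first by rewrite (eqP (TA c)).
    have /forallP/(_ d)/andP[+ _] := ssT c.
    by rewrite rcd eqxx ccd.
  have /forallP/(_ d)/andP[_] := ssT c.
  by rewrite ccd eqxx rcd /= => /orP[|/andP]; [left|right].
split; first by apply/forallP => c; apply/eqP.
apply/forallP => c; apply/forallP => d; apply/andP; split; apply/implyP.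
  by case/andP=> /eqP rcd ccd; apply: row.
case/andP=> /eqP ccd rcd; apply/orP.
by have [|[? ?]] := col c d ccd rcd; [left | right; apply/andP].
Qed.

Lemma filling_le k A (T : {ffun cell s -> 'I_k.+1}) :
  T \in fillings k A -> forall c, (T c <= k)%N.
Proof. by move=> _ c; rewrite -ltnS ltn_ord. Qed.

Lemma filling_out k A (T : {ffun cell s -> 'I_k.+1}) c :
  T \in fillings k A -> c \notin A -> T c = k :> nat.
Proof.
move=> fT nAc; apply/eqP; rewrite eqn_leq (filling_le fT) leqNgt.
by have /fillingsP[-> _ _] := fT.
Qed.

Definition below k N (T : {ffun cell s -> 'I_N}) : {set cell s} :=
  [set c | (T c < k)%N].

Lemma strip_below k A (T : {ffun cell s -> 'I_k.+2}) :
  T \in fillings k.+1 A -> strip (below k T) A.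
Proof.
move=> /fillingsP[TA row col]; apply/stripP; split=> [c|c d|c d|c d].
- by rewrite inE -TA; lia.
- by move=> rcd ccd; rewrite !inE; have := row c d rcd ccd; lia.
- by move=> rcd ccd; rewrite -!TA; have := row c d rcd ccd; lia.
- by move=> ccd rcd; rewrite !inE -!TA; have := col c d ccd rcd; lia.
Qed.

(** Once [B] is known, the filling is determined by its values on [B]: the rest of [A] carries the
    letter [k], and the strip condition makes every such extension valid. *)
Lemma card_fillings_below k A B : strip B A ->
  #|[set T in fillings k.+1 A | below k T == B]| = #|fillings k B|.
Proof.
move=> /stripP[BA rowB rowA col].
(* In a filling of [B] the cells outside [B] already carry [k], which becomes the new letter on [A]
   outside [B]; only the cells outside [A] are raised to [k.+1]. *)
pose ext (T : {ffun cell s -> 'I_k.+1}) : {ffun cell s -> 'I_k.+2} :=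
  [ffun c => inord (if c \in A then T c : nat else k.+1)].
have extE T c : ext T c = (if c \in A then T c : nat else k.+1) :> nat.
  by rewrite ffunE inordK //; have := ltn_ord (T c); case: ifP; lia.
rewrite -(card_in_imset (f := ext) (D := fillings k B)); last first.
  move=> T U fT fU eqTU.
  apply/ffunP => c; apply: val_inj => /=.
  have := extE T c; rewrite eqTU extE; case: ifPn => [_ ->//|nAc _].
  have nBc : c \notin B by apply: contra nAc; apply: BA.
  by rewrite (filling_out fT nBc) (filling_out fU nBc).
suff imE (T : {ffun cell s -> 'I_k.+2}) :
    (T \in [set T in fillings k.+1 A | below k T == B]) =
    (T \in [set ext U | U in fillings k B]) by apply: eq_card imE.
rewrite inE; apply/andP/imsetP.
  case=> fT /eqP TB; have leT := filling_le fT.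
  have /fillingsP[TA rowT colT] := fT.
  have TBE c : (T c < k)%N = (c \in B) by rewrite -TB inE.
  (* Capping the values at [k] inverts [ext]. *)
  pose U : {ffun cell s -> 'I_k.+1} := [ffun c => inord (minn (T c) k)].
  have minE c : U c = minn (T c) k :> nat by rewrite ffunE inordK //; lia.
  have extU c : T c = ext U c :> nat.
    by rewrite extE minE; have := TA c; have := leT c; case: ifP => _; lia.
  exists U; last by apply/ffunP => c; apply: val_inj; apply: extU.
  apply/fillingsP; split=> [c|c d rcd ccd|c d ccd rcd]; rewrite !minE.
  - by rewrite -TBE; lia.
  - by have := rowT c d rcd ccd; lia.
  - by have := colT c d ccd rcd; lia.
case=> U fU ->; have leU := filling_le fU.
have /fillingsP[UB rowU colU] := fU; split.
  apply/fillingsP; split=> [c|c d rcd ccd|c d ccd rcd]; rewrite !extE.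
  - by have := leU c; case: ifP; lia.
  - have := rowA c d rcd ccd; have := rowU c d rcd ccd.
    have := leU c.
    by case: (c \in A); case: (d \in A) => // ? ? dA; last have := dA isT; lia.
  - have := colU c d ccd rcd; have := col c d ccd rcd; have := BA c.
    have := UB c; have := leU c.
    case: (d \in A) => [? Uc cA /(_ isT) cB|]; last by case: (c \in A); lia.
    by rewrite cB in Uc; rewrite cA //; lia.
apply/eqP/setP => c; rewrite inE extE; case: ifPn => [_|nAc]; first exact: UB.
have -> : (c \in B) = false by apply: contraNF nAc; apply: BA.
by rewrite ltnNge leqW.
Qed.

(** Branching rule: the cells with the largest letter form a horizontal strip, and what remains is
    filled with one letter less. *)
Lemma card_fillings_succ k A :
  #|fillings k.+1 A| = (\sum_(B | strip B A) #|fillings k B|)%N.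
Proof.
rewrite -sum1_card (partition_big (fun T => below k T) (fun B => strip B A)) /=;
  last by move=> T /strip_below.
apply: eq_bigr => B AB; rewrite -(card_fillings_below k AB) -sum1_card.
by apply: eq_bigl => T; rewrite !inE.
Qed.

Lemma card_fillings0 A : #|fillings 0 A| = (A == set0).
Proof.
have [->|/set0Pn[c Ac]] := eqVneq A set0; last first.
  apply/eqP; rewrite cards_eq0; apply/eqP/setP => T; rewrite [RHS]inE.
  by apply/fillingsP => -[/(_ c)]; rewrite Ac ltn0.
rewrite (_ : fillings 0 set0 = [set [ffun=> ord0]]) ?cards1 //.
apply/setP => T; rewrite in_set1; apply/idP/eqP => [_|->].
  by apply/ffunP => c; rewrite ffunE ord1.
by apply/fillingsP; split=> [c|c d _ _|c d _ _]; rewrite ?ffunE ?inE //; right.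
Qed.

(** Here the value [k] outside the subshape is read as a genuine largest letter; the strip condition
    is what keeps it from repeating in a column. *)
Lemma strip_belowT k (T : {ffun cell s -> 'I_k.+1}) :
  ssyt T = (T \in fillings k (below k T)) && strip (below k T) setT.
Proof.
apply/forallP/andP => [ssT|[/fillingsP[_ row col] /stripP[_ _ _ strT]] c].
  have row c d : cell_row c = cell_row d -> (cell_col c <= cell_col d)%N ->
      (T c <= T d)%N.
    move=> rcd ccd; have /forallP/(_ d)/andP[+ _] := ssT c.
    by rewrite rcd ccd eqxx.
  have col c d : cell_col c = cell_col d -> (cell_row c < cell_row d)%N ->
      (T c < T d)%N.
    move=> ccd rcd; have /forallP/(_ d)/andP[_] := ssT c.
    by rewrite rcd ccd eqxx.
  split; first apply/fillingsP; last apply/stripP.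
    by split=> // [c|c d ccd rcd]; [rewrite inE | left; apply: col].
  split=> // [c d rcd ccd|c d ccd rcd _]; rewrite !inE.
    by have := row c d rcd ccd; lia.
  by have := col c d ccd rcd; have := ltn_ord (T d); lia.
apply/forallP => d; apply/andP; split; apply/implyP.
  by case/andP=> /eqP rcd ccd; apply: row.
case/andP=> /eqP ccd rcd; have := strT c d ccd rcd (in_setT _); rewrite inE.
by have := col c d ccd rcd; lia.
Qed.

(** The weight [f] allows both counting tableaux and counting the occurrences of the largest
    letter. *)
Lemma sum_ssyt_below k (f : {set cell s} -> nat) :
  (\sum_(T : {ffun cell s -> 'I_k.+1} | ssyt T) f (below k T) =
   \sum_(B | strip B setT) f B * #|fillings k B|)%N.
Proof.
rewrite (partition_big (fun T => below k T) (fun B => strip B setT)) /=;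
  last by move=> T; rewrite strip_belowT => /andP[].
apply: eq_bigr => B BT; rewrite -sum1_card big_distrr /=.
apply: eq_big => [T|T /andP[_ /eqP ->]]; last by rewrite muln1.
rewrite strip_belowT; apply/andP/idP => [[/andP[? _] /eqP <-] //|fT].
have -> : below k T = B.
  by have /fillingsP[TB _ _] := fT; apply/setP => c; rewrite inE TB.
by rewrite fT BT.
Qed.

End Strips.

(** * Polynomials counting the fillings, and their values at -1 *)

Section FillingPolynomials.
Variable F : fieldType.
Hypothesis charF0 : [pchar F] =i pred0.

Lemma natF_eq0 n : (n%:R == 0 :> F) = (n == 0%N).
Proof. by move/pcharf0P: charF0. Qed.

Lemma natF_inj : injective (fun n => n%:R : F).
Proof.
move=> m n; wlog le_mn : m n / (m <= n)%N => [IH|mn].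
  by case/orP: (leq_total m n) => [/IH//|/IH {}IH mn]; apply/esym/IH.
apply/eqP; rewrite eqn_leq le_mn -subn_eq0 -natF_eq0 natrB //.
by rewrite -mn subrr /=.
Qed.

(** A nonzero polynomial has fewer roots than its size, and in characteristic 0 the positive
    integers are distinct in [F]. *)
Lemma poly_nat_eq0 (p : {poly F}) : (forall k, p.[k.+1%:R] = 0) -> p = 0.
Proof.
move=> p0; apply/eqP; apply/negPn/negP => nz_p.
have := @max_poly_roots F p [seq k.+1%:R | k <- iota 0 (size p)] nz_p.
rewrite size_map size_iota ltnn map_inj_uniq ?iota_uniq; last first.
  by move=> i j /natF_inj [].
suff all_p : all (root p) [seq k.+1%:R | k <- iota 0 (size p)].
  by move/(_ all_p isT).
by apply/allP => _ /mapP[k _ ->]; apply/eqP/p0.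
Qed.

(** By the binomial theorem the difference of [x^(m+1)] is [(m+1) x^m] plus lower powers, whose
    antidifferences are known by induction; characteristic 0 permits the division by [m+1]. *)
Lemma antidifferenceX m :
  exists q : {poly F}, forall x, q.[x + 1] - q.[x] = x ^+ m.
Proof.
elim/ltn_ind: m => m IHm.
have IH (i : 'I_m) : exists q : {poly F}, forall x, q.[x + 1] - q.[x] = x ^+ i.
  exact: IHm.
have [q qE] := choice IH.
have nz_m : m.+1%:R != 0 :> F by rewrite natF_eq0.
exists (m.+1%:R^-1 *: ('X^(m.+1) - \sum_(i < m) 'C(m.+1, i)%:R *: q i)) => x.
rewrite !hornerZ -mulrBr !hornerD !hornerN !hornerXn !horner_sum.
have -> : (x + 1) ^+ m.+1 =
    \sum_(i < m) 'C(m.+1, i)%:R * x ^+ i + m.+1%:R * x ^+ m + x ^+ m.+1.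
  rewrite addrC exprDn 2!big_ord_recr /= !expr1n !mul1r binn mulr1n.
  rewrite binSn -[_ *+ m.+1]mulr_natl; congr (_ + _ + _).
  by apply: eq_bigr => i _; rewrite expr1n mul1r mulr_natl.
set S := \sum_(i < m) _ * _; set U := \sum_(i < m) _; set V := \sum_(i < m) _.
have -> : S = U - V.
  rewrite -sumrB; apply: eq_bigr => i _.
  by rewrite !hornerZ -mulrBr qE.
move: (x ^+ _) (x ^+ _) U V => u v U V.
by rewrite [X in _ * X](_ : _ = m.+1%:R * v) ?mulKf //; ring.
Qed.

Lemma antidifference (r : {poly F}) :
  exists q : {poly F}, forall x, q.[x + 1] - q.[x] = r.[x].
Proof.
have [q qE] := choice antidifferenceX.
exists (\sum_(i < size r) r`_i *: q i) => x.
rewrite !horner_sum -sumrB horner_coef; apply: eq_bigr => i _.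
by rewrite !hornerZ -mulrBr qE.
Qed.

Section Shape.
Variable s : seq nat.
Implicit Types A B : {set cell s}.

Lemma strip_refl B A : strip B A -> strip A A.
Proof.
move=> /stripP[BA rowB rowA col]; apply/stripP; split=> // c d ccd rcd dA.
exact/BA/(col c d).
Qed.

Lemma strip_below_refl B A : strip B A -> strip B B.
Proof.
move=> /stripP[BA rowB rowA col]; apply/stripP; split=> // c d ccd rcd /BA.
exact: col.
Qed.

Lemma strip_set0 : strip (set0 : {set cell s}) set0.
Proof. by apply/stripP; split=> // c d; rewrite inE. Qed.

(** By the branching rule, the difference in [k] of the count for [A] is the sum of the counts for
    proper subshapes, a polynomial by induction on the size of [A]. *)
Lemma filling_poly_ex A : exists p : {poly F},
  forall k, p.[k%:R] = #|fillings k A|%:R.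
Proof.
have [n leAn] := ubnP #|A|; elim: n A leAn => // n IHn A; rewrite ltnS => leAn.
(* [strip A A] means that [A] is closed leftwards and upwards; any other set has no filling. *)
have [AA|nAA] := boolP (strip A A); last first.
  exists 0 => -[|k]; rewrite horner0.
    rewrite card_fillings0; case: eqP => // A0.
    by rewrite A0 strip_set0 in nAA.
  rewrite card_fillings_succ big1 // => B /strip_refl AA.
  by rewrite AA in nAA.
have IH B : exists p : {poly F}, strip B A && (B != A) ->
    forall k, p.[k%:R] = #|fillings k B|%:R.
  have [/andP[BA neqBA]|_] := boolP (strip B A && (B != A)); last by exists 0.
  have [|p pE] := IHn B; last by exists p.
  apply: leq_trans leAn; rewrite proper_card // properEneq neqBA.
  by case/and3P: BA.
have [p pE] := choice IH.
have [q qE] := antidifference (\sum_(B | strip B A && (B != A)) p B).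
(* The constant adjusts the antidifference to the right value at [k = 0]. *)
exists (q + (#|fillings 0 A|%:R - q.[0])%:P); elim=> [|k IHk].
  by rewrite hornerD hornerC addrC subrK.
rewrite card_fillings_succ (bigD1 A) //= natrD -IHk natr_sum.
rewrite !hornerD !hornerC -natr1.
have -> : q.[k%:R + 1] =
    q.[k%:R] + (\sum_(B | strip B A && (B != A)) p B).[k%:R].
  by rewrite -qE addrCA subrr addr0.
rewrite horner_sum -!addrA; congr (_ + _); rewrite addrC -!addrA.
congr (_ + (_ + _)); apply: eq_bigr => B /pE; exact.
Qed.

Variable p : {set cell s} -> {poly F}.
Hypothesis pE : forall A k, (p A).[k%:R] = #|fillings k A|%:R.

(** The branching rule holds at all positive integers, hence as an identity of polynomials; it is
    needed at [x = -1]. *)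
Lemma filling_poly_succ A x :
  (p A).[x + 1] = \sum_(B | strip B A) (p B).[x].
Proof.
pose q := p A \Po ('X + 1) - \sum_(B | strip B A) p B.
suff : q = 0.
  move/(congr1 (fun r : {poly F} => r.[x])).
  rewrite /q hornerD hornerN horner_comp hornerD hornerX hornerC horner_sum horner0.
  by move/eqP; rewrite subr_eq0 => /eqP.
apply: poly_nat_eq0 => k.
rewrite /q hornerD hornerN horner_comp hornerD hornerX hornerC horner_sum.
rewrite natr1 pE card_fillings_succ natr_sum -sumrB big1 // => B _.
by rewrite pE subrr.
Qed.

Lemma filling_poly0 A : (p A).[0] = (A == set0)%:R.
Proof. by rewrite (pE A 0) card_fillings0. Qed.

Definition first_column A := [forall c in A, cell_col c == 0%N].

(** For a shape, the value of the filling polynomial at -1. It agrees with the reciprocity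
    [N_A(-k) = (-1)^|A| N_A'(k)] for the conjugate shape [A']: one letter fills only a single
    row. *)
Definition column_sign A : F := (first_column A)%:R * (-1) ^+ #|A|.

(* Toggling the lowest cell of the first column of A reverses the signs. *)
Lemma sum_column_sign A : strip A A ->
  \sum_(B | strip B A) column_sign B = (A == set0)%:R.
Proof.
move=> AA; have [->|/set0Pn[c0 Ac0]] := eqVneq A set0.
  rewrite (big_pred1 set0) => [|B].
    rewrite /column_sign cards0 expr0 mulr1.
    by rewrite (_ : first_column set0) //; apply/forallP => c; rewrite inE.
  apply/idP/eqP => [/and3P[]|->]; last exact: strip_set0.
  by rewrite subset0 => /eqP.
have /stripP[_ rowA _ colA] := AA.
have lt_r0 := cell_row_lt c0.
have lt_k0 : (0 < nth 0 s (cell_row c0))%N.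
  exact: leq_ltn_trans (leq0n _) (cell_col_lt c0).
have [c1 [rc1 cc1]] := ex_cell lt_r0 lt_k0.
have c1A : (c1 \in A) && (cell_col c1 == 0%N).
  by rewrite cc1 eqxx andbT; apply: rowA Ac0; rewrite ?cc1.
have [x /andP[Ax /eqP cx] max_x] := @arg_maxnP _ c1
  [pred c | (c \in A) && (cell_col c == 0%N)] (@cell_row s) c1A.
pose toggle B := if x \in B then B :\ x else x |: B.
have toggleK : involutive toggle.
  move=> B; rewrite /toggle; case: (boolP (x \in B)) => Bx.
    by rewrite setD11 setD1K.
  by rewrite setU11 setU1K.
(* Removing [x] is allowed because no cell of [A] lies below it, and adding [x] because it starts
   its row. *)
have sign_toggle B : strip B A && first_column B ->
    strip (toggle B) A && first_column (toggle B).
  case/andP=> /stripP[BA rowB _ colB] /forall_inP B0; rewrite /toggle.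
  have col0_eq (c d : cell s) :
      cell_row c = cell_row d -> (cell_col c <= cell_col d)%N ->
      cell_col d = 0%N -> c = d.
    by move=> rcd ccd d0; apply: cell_eqP => //; lia.
  case: ifPn => Bx; apply/andP; split.
  - apply/stripP; split=> [c|c d rcd ccd|//|c d ccd rcd Ad].
    + by rewrite in_setD1 => /andP[_ /BA].
    + case/setD1P=> xd Bd; rewrite (col0_eq c d rcd ccd) ?(eqP (B0 d Bd)) //.
      exact/setD1P.
    + rewrite in_setD1 (colB c d) // andbT; apply/eqP => cx'.
      have : (d \in A) && (cell_col d == 0%N) by rewrite Ad -ccd cx' cx eqxx.
      by move/max_x; rewrite /= -cx' leqNgt rcd.
  - by apply/forall_inP => c /setD1P[_ /B0].
  - apply/stripP; split=> [c|c d rcd ccd|//|c d ccd rcd Ad].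
    + by case/setU1P=> [->|/BA].
    + case/setU1P=> [dx|Bd]; last by rewrite in_setU1 (rowB c d) ?orbT.
      by rewrite (col0_eq c d rcd ccd) dx ?setU11.
    + by rewrite in_setU1 (colB c d) ?orbT.
  - by apply/forall_inP => c /setU1P[->|/B0 //]; rewrite cx.
have sign_toggleE B : strip (toggle B) A && first_column (toggle B) =
    strip B A && first_column B.
  by apply/idP/idP => /sign_toggle; rewrite ?toggleK.
set S := LHS.
have SE : S = \sum_(B | strip B A && first_column B) (-1) ^+ #|B|.
  rewrite /S (bigID first_column) /= addrC big1 ?add0r; last first.
    by move=> B /andP[_ /negbTE nB]; rewrite /column_sign nB mul0r.
  by apply: eq_bigr => B /andP[_ B0]; rewrite /column_sign B0 mul1r.
have : S = - S.
  rewrite {1}SE (reindex_inj (inv_inj toggleK)) /= (eq_bigl _ _ sign_toggleE).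
  rewrite SE -sumrN; apply: eq_bigr => B _; rewrite /toggle.
  case: ifPn => Bx; first by rewrite [in RHS](cardsD1 x) Bx exprS mulN1r opprK.
  by rewrite cardsU1 Bx exprS mulN1r.
move/eqP; rewrite -addr_eq0 -mulr2n -[S *+ 2]mulr_natl.
rewrite mulf_eq0 natF_eq0 /=.
by move/eqP.
Qed.

(** The values at -1 and the signs satisfy the same recursion over strips with the same right-hand
    side; it determines the term for [A] from those for proper subshapes. *)
Lemma filling_polyN1 A : strip A A -> (p A).[-1] = column_sign A.
Proof.
have [n leAn] := ubnP #|A|; elim: n A leAn => // n IHn A; rewrite ltnS => leAn AA.
have := filling_poly_succ A (-1); rewrite addNr filling_poly0 -sum_column_sign //.
rewrite (bigD1 A) //= [in RHS](bigD1 A) //=.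
rewrite [X in _ + X = _](eq_bigr (fun B => (p B).[-1])) => [/addIr ->//|].
move=> B /andP[BA neqBA]; rewrite IHn ?(strip_below_refl BA) //.
apply: leq_trans leAn; rewrite proper_card // properEneq neqBA.
by case/and3P: BA.
Qed.

End Shape.
End FillingPolynomials.

(** * The derivative of the filling polynomial at 0 *)

Section Derivative.
Variable F : fieldType.
Hypothesis charF0 : [pchar F] =i pred0.

(** A tableau is sent to ['X] to the number of its letters [v], so the derivative at 1 counts the
    occurrences of [v]. *)
Definition mark_letter N (v : 'I_N) : {mpoly F[N]} -> {poly F} :=
  mmap (@polyC F) (fun i => if i == v then 'X else 1).

HB.instance Definition _ N (v : 'I_N) := GRing.RMorphism.copy (mark_letter v)
  (mmap (@polyC F) (fun i => if i == v then 'X else 1)).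

Lemma mark_letterX N (v i : 'I_N) :
  mark_letter v 'X_i = if i == v then 'X else 1.
Proof. by rewrite /mark_letter mmapX mmap1U. Qed.

Lemma mark_letter_msym N (v w : 'I_N) (q : {mpoly F[N]}) :
  mark_letter v (msym (tperm v w) q) = mark_letter w q.
Proof.
apply: (@mpoly_morph_ext F _ N (@mark_letter N v \o @msym N F (tperm v w))
  (@mark_letter N w)) => [c|i] /=.
  by rewrite /msym mmapC /mark_letter !mmapC.
rewrite /msym mmapX mmap1U !mark_letterX; congr (if _ then _ else _).
by rewrite (canF_eq (tpermK v w)) tpermL.
Qed.

Variable s : seq nat.

Definition letter_count N (v : 'I_N) : nat :=
  \sum_(T : {ffun cell s -> 'I_N} | ssyt T) #|[set c | T c == v]|.

Lemma mark_letter_schur N (v : 'I_N) :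
  mark_letter v (schur F s N) =
    \sum_(T : {ffun cell s -> 'I_N} | ssyt T) 'X^#|[set c | T c == v]|.
Proof.
rewrite /schur rmorph_sum; apply: eq_bigr => T _; rewrite rmorph_prod.
rewrite (eq_bigr (fun c => if T c == v then 'X else 1)) => [|c _].
  rewrite -big_mkcond prodr_const /=; congr ('X^_).
  by apply: eq_card => c; rewrite [RHS]inE.
exact: mark_letterX.
Qed.

(** Transposing two variables exchanges their markings. Symmetry is a hypothesis here; in the final
    argument it comes from membership in [Lambda F]. *)
Lemma letter_count_sym N (v w : 'I_N) : schur F s N \is symmetric ->
  (letter_count v)%:R = (letter_count w)%:R :> F.
Proof.
move=> /issymP/(_ (tperm v w)) sym_s.
have countE (u : 'I_N) :
    (letter_count u)%:R = ((mark_letter u (schur F s N))^`()).[1].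
  rewrite mark_letter_schur (raddf_sum (@deriv F)) horner_sum /letter_count natr_sum.
  by apply: eq_bigr => T _; rewrite /= derivXn hornerMn hornerXn expr1n.
by rewrite !countE -[in LHS]sym_s mark_letter_msym.
Qed.

(** Double counting of the pairs of a tableau and a cell, sorted by the letter in the cell. *)
Lemma sum_letter_count k :
  (\sum_(v < k.+1) letter_count v = #|cell s| * #|fillings k.+1 [set: cell s]|)%N.
Proof.
rewrite card_fillings_succ big_distrr /= -(sum_ssyt_below k (fun=> #|cell s|)).
rewrite /letter_count exchange_big; apply: eq_bigr => T _.
rewrite -sum1_card (partition_big T predT) //=; apply: eq_bigr => v _.
by rewrite -sum1_card; apply: eq_bigl => c; rewrite inE.
Qed.

Lemma letter_count_max k :
  (letter_count (@ord_max k) =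
   \sum_(B : {set cell s} | strip B setT) #|~: B| * #|fillings k B|)%N.
Proof.
rewrite -sum_ssyt_below; apply: eq_bigr => T _; apply: eq_card => c.
rewrite !inE -val_eqE /= -leqNgt eqn_leq andbC.
by rewrite -[X in _ && X]ltnS ltn_ord andbT.
Qed.

Variable p : {set cell s} -> {poly F}.
Hypothesis pE : forall A k, (p A).[k%:R] = #|fillings k A|%:R.

(* By symmetry the largest letter occurs as often as any other. *)
Lemma filling_poly_max_letter : (forall N, schur F s N \is symmetric) ->
  #|cell s|%:R *: p setT =
  'X * \sum_(B | strip B setT) #|~: B|%:R *: (p B \Po ('X - 1)).
Proof.
move=> sym_s; apply/eqP; rewrite -subr_eq0; apply/eqP.
apply: (poly_nat_eq0 charF0) => k.
rewrite hornerD hornerN hornerZ hornerM hornerX horner_sum pE -natrM.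
rewrite -sum_letter_count natr_sum.
rewrite (eq_bigr (fun=> (letter_count (@ord_max k))%:R)); last first.
  by move=> v _; apply: letter_count_sym.
rewrite sumr_const card_ord -[_ *+ k.+1]mulr_natl letter_count_max natr_sum.
apply/eqP; rewrite subr_eq0; apply/eqP; congr (_ * _).
apply: eq_bigr => B _; rewrite hornerZ horner_comp hornerD hornerN hornerX.
by rewrite hornerC -natr1 addrK pE natrM.
Qed.

(** Differentiating the preceding identity at 0 leaves the values at -1 of the shapes [B]. Each [B]
    contains [c], because [d] lies below [c], so [B] is not a single column and its value is 0. *)
Lemma filling_poly_deriv0 (c d : cell s) :
  (forall N, schur F s N \is symmetric) ->
  cell_col c = cell_col d -> (0 < cell_col c)%N -> (cell_row c < cell_row d)%N ->
  ((p setT)^`()).[0] = 0.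
Proof.
move=> sym_s ccd c_gt0 rcd.
have /(congr1 (fun q : {poly F} => q^`().[0])) := filling_poly_max_letter sym_s.
rewrite derivZ derivM derivX mul1r hornerD hornerM hornerX mul0r addr0 hornerZ.
rewrite horner_sum big1 => [/eqP|B BT]; last first.
  rewrite hornerZ horner_comp hornerD hornerN hornerX hornerC sub0r.
  rewrite (filling_polyN1 charF0 pE (strip_below_refl BT)) /column_sign.
  have /stripP[_ _ _ /(_ c d ccd rcd (in_setT d)) Bc] := BT.
  suff /negbTE -> : ~~ first_column B by rewrite mul0r mulr0.
  by apply/negP => /forall_inP/(_ c Bc); rewrite eqn0Ngt c_gt0.
rewrite mulf_eq0 (natF_eq0 charF0) => /orP[/eqP/card0_eq/(_ c)|/eqP//].
by rewrite !inE.
Qed.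

End Derivative.

(** * Power sums and the specialization to equal variables *)

Section PowerSum.
Variable F : fieldType.

Definition power_sum n : mpfam F := fun N => \sum_(i < N) 'X_i ^+ n.

(** For [n = 0] the family would be the constant [N], which is not compatible with restriction. *)
Lemma power_sum_Lambda n : (0 < n)%N -> power_sum n \in Lambda F.
Proof.
move=> n_gt0; apply/asboolP; split=> [N|N|].
- apply/issymP => t; rewrite /power_sum (raddf_sum (msym t)) /=.
  rewrite [RHS](reindex_inj (@perm_inj _ t)); apply: eq_bigr => i _.
  by rewrite rmorphXn /= /msym mmapX mmap1U.
- rewrite /power_sum (raddf_sum (@restrict_last F N)) big_ord_recr /=.
  rewrite rmorphXn /= restrict_lastXmax expr0n eqn0Ngt n_gt0 addr0.
  apply: eq_bigr => i _; rewrite rmorphXn /=.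
  have -> : widen_ord (leqnSn N) i = lift ord_max i.
    by apply/val_inj; rewrite /= /bump leqNgt ltn_ord.
  by rewrite restrict_lastXlift.
exists n.+1 => N; apply: msize_homog; apply: rpred_sum => i _.
have hom_X : ('X_i : {mpoly F[N]}) \is 1.-homog by rewrite dhomogX /= mdeg1.
by have := dhomogMn n hom_X; rewrite mul1n.
Qed.

End PowerSum.

Section Diagonal.
Variable F : fieldType.

(** Sets [k] variables to one variable [t] and the others to 0; the powers of [t] keep track of the
    degree. *)
Definition diagonal k (f : mpfam F) : {poly F} :=
  mmap (@polyC F) (fun=> 'X) (f k).

Fact diagonal_additive k : additive (diagonal k).
Proof. by move=> f g; rewrite /diagonal -raddfB. Qed.
Fact diagonal_multiplicative k : multiplicative (diagonal k).
Proof. by split=> [f g|]; rewrite /diagonal -?rmorphM ?rmorph1. Qed.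
HB.instance Definition _ k :=
  GRing.isAdditive.Build _ _ _ (@diagonal_additive k).
HB.instance Definition _ k :=
  GRing.isMultiplicative.Build _ _ _ (@diagonal_multiplicative k).

Lemma diagonal_alg k (c : F) : diagonal k c%:A = c%:P.
Proof.
rewrite -[LHS]/(mmap (@polyC F) (fun=> 'X) (c *: 1 : {mpoly F[k]})).
by rewrite -mul_mpolyC mulr1 mmapC.
Qed.

Lemma diagonal_power_sum k n : diagonal k (power_sum F n) = k%:R *: 'X^n.
Proof.
rewrite /diagonal rmorph_sum /= (eq_bigr (fun=> 'X^n)) => [|i _].
  by rewrite sumr_const card_ord -scaler_nat.
by rewrite rmorphXn /= mmapX mmap1U.
Qed.

Lemma card_cell s : #|cell s| = sumn s.
Proof.
rewrite card_tagged [LHS]sumnE big_map big_enum /=.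
rewrite [RHS]sumnE (big_nth 0%N) big_mkord.
by apply: eq_bigr => i _; rewrite card_ord.
Qed.

Lemma diagonal_schur k s :
  diagonal k (schur F s) =
    #|[pred T : {ffun cell s -> 'I_k} | ssyt T]|%:R *: 'X^(sumn s).
Proof.
rewrite /diagonal rmorph_sum /= (eq_bigr (fun=> 'X^(sumn s))) => [|T _].
  by rewrite sumr_const -scaler_nat.
rewrite rmorph_prod /= (eq_bigr (fun=> 'X)) => [|c _]; last by rewrite mmapX mmap1U.
by rewrite prodr_const card_cell.
Qed.

Lemma card_ssyt k s :
  #|[pred T : {ffun cell s -> 'I_k.+1} | ssyt T]| = #|fillings k.+1 [set: cell s]|.
Proof.
rewrite card_fillings_succ -sum1_card.
have := sum_ssyt_below k (fun=> 1%N : nat) (s := s).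
by under [X in _ = X -> _]eq_bigr do rewrite mul1n.
Qed.

End Diagonal.

(** * Terms linear in [K] in polynomial expressions *)

Section Linearization.
Variables (F : fieldType) (n : nat).
Hypothesis n_gt0 : (0 < n)%N.
Implicit Types Q R : {poly {poly F}}.

(* For Q in F[K][t]: Q is constant in t at K = 0, and the derivative in K at 0
   has no term in t^n. *)
Definition flat Q : Prop :=
  (forall i, (0 < i)%N -> (Q`_i).[0] = 0) /\ ((Q`_n)^`()).[0] = 0.

Lemma flatC (c : {poly F}) : flat c%:P.
Proof.
split=> [i i_gt0|]; rewrite coefC.
  by rewrite eqn0Ngt i_gt0 horner0.
by rewrite eqn0Ngt n_gt0 linear0 horner0.
Qed.

Lemma flatD Q R : flat Q -> flat R -> flat (Q + R).
Proof.
move=> [Q0 Qn] [R0 Rn]; split=> [i i_gt0|].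
  by rewrite coefD hornerD Q0 ?R0 ?addr0.
by rewrite coefD derivD hornerD Qn Rn addr0.
Qed.

(** In Leibniz's rule the undifferentiated factor vanishes at [K = 0] unless its index in [t] is 0;
    then the other factor is the derivative of the coefficient of index [n], which vanishes
    there. *)
Lemma flatM Q R : flat Q -> flat R -> flat (Q * R).
Proof.
move=> [Q0 Qn] [R0 Rn]; split=> [i i_gt0|].
  rewrite coefM horner_sum big1 // => -[j lt_ji] _ /=; rewrite hornerM.
  case: j lt_ji => [|j] _; last by rewrite Q0 ?mul0r.
  by rewrite subn0 R0 ?mulr0.
rewrite coefM (raddf_sum (@deriv F)) horner_sum big1 // => -[j lt_jn] _ /=.
rewrite derivM hornerD !hornerM.
have [->|neq_jn] := eqVneq j n.
  by rewrite Qn mul0r add0r Q0 // mul0r.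
rewrite R0 ?mulr0 ?add0r; last by rewrite subn_gt0 ltn_neqAle neq_jn.
case: j {lt_jn neq_jn} => [|j]; last by rewrite Q0 ?mul0r.
by rewrite subn0 Rn mulr0.
Qed.

Lemma flatXn (q : {poly F}) j :
  ((0 < j)%N -> q.[0] = 0) -> (j = n -> (q^`()).[0] = 0) -> flat (q%:P * 'X^j).
Proof.
move=> q0 q1; split=> [i i_gt0|]; rewrite coefCM coefXn.
  have [ij|_] := eqVneq i j; last by rewrite mulr0 horner0.
  by rewrite mulr1 q0 -?ij.
have [nj|_] := eqVneq n j; last by rewrite mulr0 linear0 horner0.
by rewrite mulr1 q1.
Qed.

Lemma flat_mmap m (P : {mpoly F[m]}) (h : 'I_m -> {poly {poly F}}) :
  (forall i, flat (h i)) -> flat (mmap (polyC \o @polyC F) h P).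
Proof.
move=> h_flat; rewrite /mmap; apply: big_ind => [||k _]; first exact: (flatC 0).
  exact: flatD.
apply: flatM; first exact: flatC.
rewrite /mmap1; apply: big_ind => [||i _]; [exact: (flatC 1)|exact: flatM|].
elim: (k i) => [|e IHe]; first exact: (flatC 1).
by rewrite exprS; apply: flatM.
Qed.

End Linearization.

(** * Shapes that are not hooks, and the converse implication *)

Lemma part0 s : is_part 0 s -> s = [::].
Proof. by case/and3P=> _ nz_s /eqP; case: s nz_s => [|[|k] l]. Qed.

(** A partition that is not a hook has a second row of length at least 2; the cells are those of
    column 1 in the first two rows. *)
Lemma part_not_hook n s : is_part n s -> ~ is_hook s ->
  exists c d : cell s,
    [/\ cell_col c = cell_col d, (0 < cell_col c)%N & (cell_row c < cell_row d)%N].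
Proof.
case/and3P=> sorted_s nz_s _ not_hook.
case: s sorted_s nz_s not_hook => [_ _ []|a [|b l]]; first by left.
  rewrite inE => _; rewrite eq_sym -lt0n => a_gt0 [].
  by right; exists a, 0%N.
move=> /= /andP[le_ba path_l] nz_s not_hook.
have b_gt1 : (1 < b)%N.
  rewrite ltnNge; apply/negP => b_le1; apply: not_hook; right.
  exists a, (size l).+1.
  move: nz_s; rewrite !inE !negb_or ![0%N == _]eq_sym -!lt0n => /and3P[a_gt0 b_gt0 nz_l].
  split=> //; have b1 : b = 1%N by lia.
  rewrite b1 in path_l *; congr [:: _, _ & _].
  apply/all_pred1P/allP => x lx /=.
  have trans_geq : transitive geq by move=> u v w /= uv vw; apply: leq_trans vw uv.
  have /allP/(_ x lx) /= x_le1 := order_path_min trans_geq path_l.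
  have x_neq0 : x != 0%N by apply: contraNneq nz_l => <-.
  by rewrite eqn_leq x_le1 lt0n.
have [c [rc cc]] := @ex_cell [:: a, b & l] 0 1 isT (leq_trans b_gt1 le_ba).
have [d [rd cd]] := @ex_cell [:: a, b & l] 1 1 isT b_gt1.
by exists c, d; rewrite rc cc rd cd.
Qed.

Section Generation.
Variable F : fieldType.
Hypothesis charF0 : [pchar F] =i pred0.

Lemma diagonal_peval (u : nat -> mpfam F) m (P : {mpoly F[m]}) k :
  diagonal k (peval u P) =
    mmap (@polyC F) (fun i : 'I_m => diagonal k (u i)) P.
Proof.
apply: (@mpoly_morph_ext F _ m (@diagonal F k \o @peval F _ u m)
  (mmap (@polyC F) (fun i : 'I_m => diagonal k (u i)))) => [c|i] /=.
  by rewrite pevalC diagonal_alg mmapC.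
by rewrite pevalX mmapX mmap1U.
Qed.

Lemma mmap_specialize m (P : {mpoly F[m]}) (q : nat -> {poly F}) x :
  map_poly (horner_eval x)
    (mmap (polyC \o @polyC F) (fun i : 'I_m => (q i)%:P * 'X^i) P) =
  mmap (@polyC F) (fun i : 'I_m => (q i).[x] *: 'X^i) P.
Proof.
apply: (@mpoly_morph_ext F _ m (map_poly (horner_eval x) \o
    mmap (polyC \o @polyC F) (fun i : 'I_m => (q i)%:P * 'X^i))
  (mmap (@polyC F) (fun i : 'I_m => (q i).[x] *: 'X^i))) => [c|i] /=.
  by rewrite !mmapC /= map_polyC /= /horner_eval hornerC.
rewrite !mmapX !mmap1U rmorphM /= map_polyC map_polyXn /= /horner_eval.
by rewrite mul_polyC.
Qed.

Lemma generates_hook (lam : nat -> seq nat) :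
  (forall n, is_part n (lam n)) ->
  generates (fun n => schur F (lam n)) (Lambda F) ->
  forall n, is_hook (lam n).
Proof.
set u := fun n => schur F (lam n) => lamP gen_u n.
apply: contrapT => not_hook.
have [c [d [ccd c_gt0 rcd]]] := part_not_hook (lamP n) not_hook.
have n_gt0 : (0 < n)%N.
  rewrite lt0n; apply/eqP => n0; apply: not_hook; left.
  by apply: part0; rewrite -[X in is_part X]n0.
have sumn_lam j : sumn (lam j) = j by have /and3P[_ _ /eqP] := lamP j.
(* The generators themselves lie in the generated algebra, which is [Lambda F]. *)
have sym_u j N : schur F (lam j) N \is symmetric.
  have /asboolP[+ _ _] : u j \in Lambda F; last exact.
  by apply/gen_u; exists j.+1, 'X_ord_max; rewrite pevalX.
have qE j : exists q : {poly F},
    [/\ forall k, q.[k.+1%:R] =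
          #|[pred T : {ffun cell (lam j) -> 'I_k.+1} | ssyt T]|%:R,
        (0 < j)%N -> q.[0] = 0 & j = n -> (q^`()).[0] = 0].
  have [p pE] := choice (filling_poly_ex charF0 (s := lam j)).
  exists (p setT); split=> [k|j_gt0|jn]; first by rewrite pE card_ssyt.
    rewrite (filling_poly0 pE) -cards_eq0 cardsT card_cell sumn_lam.
    by rewrite eqn0Ngt j_gt0.
  move: p pE; rewrite jn => p pE.
  exact: (filling_poly_deriv0 charF0 pE (c := c) (d := d)).
have [q {}qE] := choice qE.
have /gen_u[m [P pow_nE]] := power_sum_Lambda F n_gt0.
(* The expression of the power sum, with each Schur function replaced by its filling polynomial in
   [K] times the power of [t] given by its degree. *)
pose Q := mmap (polyC \o @polyC F) (fun i : 'I_m => (q i)%:P * 'X^i) P.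
(* For [K = k.+1] this is the diagonal specialization of the power sum, and infinitely many values
   of [K] suffice. *)
have Qn : Q`_n = 'X.
  apply/eqP; rewrite -subr_eq0; apply/eqP; apply: (poly_nat_eq0 charF0) => k.
  have -> : (Q`_n - 'X).[k.+1%:R] = (map_poly (horner_eval k.+1%:R) Q)`_n - k.+1%:R.
    by rewrite hornerD hornerN hornerX coef_map.
  have := congr1 (diagonal k.+1) pow_nE.
  rewrite mmap_specialize diagonal_power_sum diagonal_peval.
  have -> : (fun i : 'I_m => diagonal k.+1 (u i)) =
      (fun i : 'I_m => (q i).[k.+1%:R] *: 'X^i).
    apply: functional_extensionality_dep => i; rewrite diagonal_schur sumn_lam.
    by have [-> _ _] := qE i.
  by move=> <-; rewrite coefZ coefXn eqxx mulr1 subrr.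
(* Only the generator of degree [n] could contribute a term [K t^n], and its derivative at 0
   vanishes because [lam n] is not a hook. *)
have : flat n Q.
  by apply: flat_mmap => // i; have [_ q0 q1] := qE i; apply: flatXn.
by case=> _; rewrite Qn derivX hornerC => /eqP; rewrite oner_eq0.
Qed.

End Generation.

Theorem theorem3p12 (F : fieldType) (charF0 : [pchar F] =i pred0)
    (lam : nat -> seq nat) (lamP : forall n : nat, is_part n (lam n)) :
  (alg_independent (fun n : nat => schur F (lam n.+1)) /\
   generates (fun n : nat => schur F (lam n)) (Lambda F))
  <-> (forall n : nat, is_hook (lam n)).
Proof.
split=> [[_ gen_u] n|hook_lam]; first exact: generates_hook gen_u n.
exact: hooks_generate.
Qed.
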